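(* Let $d=3$, let $\Omega\subset\mathbb{R}^3$ be a bounded Lipschitz polytope, and let $s\in[3,4]$. Let $\nu,\kappa\in C^{0,1}(\mathbb{R})$, with Lipschitz constants $\mathcal{L}_\nu,\mathcal{L}_\kappa$, satisfy $\nu_-\le\nu(r)\le\nu_+$ and $\kappa_-\le\kappa(r)\le\kappa_+$ for all $r\in\mathbb{R}$, with positive constants $\nu_\pm,\kappa_\pm$. Let $\mathbf{f}\in\mathbf{H}^{-1}(\Omega)$ and $g\in H^{-1}(\Omega)$. Assume that the discrete coupled problem (on a mesh $\mathscr{T}_h\in\mathbb{T}$) has a solution $(\mathbf{u}_{h1},\mathsf{p}_{h1},T_{h1})\in(\mathbf{W}^{1,3}(\Omega)\cap\mathbf{X}_h)\times M_h\times(W^{1,3}(\Omega)\cap Y_h)$ such that $$\frac{\mathcal{C}_N}{\nu_-^2}\|\mathbf{f}\|_{\mathbf{H}^{-1}(\Omega)}+\frac{\mathcal{L}_\nu\mathcal{C}_{6\hookrightarrow2}\mathcal{C}_{4\hookrightarrow2}^2\|g\|_{H^{-1}(\Omega)}\|\nabla\mathbf{u}_{h1}\|_{\mathbf{L}^3(\Omega)}}{\nu_-\kappa_-\left(\kappa_--\mathcal{L}_\kappa\mathcal{C}_{6\hookrightarrow2}\|\nabla T_{h1}\|_{\mathbf{L}^3(\Omega)}\right)}<1,\qquad\mathcal{L}_\kappa\mathcal{C}_{6\hookrightarrow2}\|\nabla T_{h1}\|_{\mathbf{L}^3(\Omega)}<\kappa_-.$$ Then the discrete coupled problem has no other solution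 $(\mathbf{u}_{h2},\mathsf{p}_{h2},T_{h2})\in\mathbf{X}_h\times M_h\times Y_h$.
   Context: Bold letters denote $\mathbb{R}^d$-valued functions and their spaces; $|\cdot|$ is the Euclidean norm. $L_0^2(\Omega)$ is the space of $L^2(\Omega)$ functions with zero mean. $H^{-1}(\Omega)$ and $\mathbf{H}^{-1}(\Omega)$ are the duals of $H_0^1(\Omega)$ and $\mathbf{H}_0^1(\Omega)$, with dual norms taken with respect to the norm $\|\nabla\cdot\|_{L^2(\Omega)}$. Meshes and spaces. $\mathbb{T}=\{\mathscr{T}_h\}_{h>0}$ is a shape-regular family of conforming partitions of $\bar\Omega$ into closed simplices $K$, refinements of an initial mesh $\mathscr{T}_0$, with $h=\max_K\mathrm{diam}(K)$. The pair $(\mathbf{X}_h,M_h)$ is one of: (1) Taylor--Hood: $\mathbf{X}_h=\{\mathbf{v}_h\in\mathbf{C}(\bar\Omega):\mathbf{v}_h|_K\in[\mathbb{P}_2(K)]^d\ \forall K\in\mathscr{T}_h\}\cap\mathbf{H}_0^1(\Omega)$, $M_h=\{\mathsf{q}_h\in L_0^2(\Omega)\cap C(\bar\Omega):\mathsf{q}_h|_K\in\mathbb{P}_1(K)\ \forall K\in\mathscr{T}_h\}$; (2) mini element: $\mathbf{X}_h=\{\mathbf{v}_h\in\mathbf{C}(\bar\Omega):\mathbf{v}_h|_K\in[\mathbb{P}_1(K)\oplus\mathbb{B}(K)]^d\ \forall K\in\mathscr{T}_h\}\cap\mathbf{H}_0^1(\Omega)$, with $\mathbb{B}(K)$ the span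 of a local bubble function on $K$, and the same $M_h$. It satisfies the uniform discrete inf-sup condition: with some $\tilde\beta>0$ independent of $h$, $\inf_{\mathsf{q}_h\in M_h\setminus\{0\}}\sup_{\mathbf{v}_h\in\mathbf{X}_h\setminus\{0\}}\frac{\int_\Omega\mathsf{q}_h\,\mathrm{div}\,\mathbf{v}_h\,\mathrm{d}x}{\|\nabla\mathbf{v}_h\|_{\mathbf{L}^2(\Omega)}\|\mathsf{q}_h\|_{L^2(\Omega)}}\ge\tilde\beta$. Further, $Y_h=\{S_h\in C(\bar\Omega):S_h|_K\in\mathbb{P}_{\mathfrak{r}}(K)\ \forall K\in\mathscr{T}_h\}\cap H_0^1(\Omega)$ with $\mathfrak{r}=2$ in case (1) and $\mathfrak{r}=1$ in case (2). Discrete coupled problem. Let $a_N(\mathbf{u};\mathbf{v},\mathbf{w})=\int_\Omega(\mathbf{u}\cdot\nabla)\mathbf{v}\cdot\mathbf{w}\,\mathrm{d}x$, $a_{SN}(\mathbf{u};\mathbf{v},\mathbf{w})=\frac12[a_N(\mathbf{u};\mathbf{v},\mathbf{w})-a_N(\mathbf{u};\mathbf{w},\mathbf{v})]$, $a_{ST}(\mathbf{v};T,S)=\frac12\int_\Omega((\mathbf{v}\cdot\nabla T)S-(\mathbf{v}\cdot\nabla S)T)\,\mathrm{d}x$. Find $(\mathbf{u}_h,\mathsf{p}_h,T_h)\in\mathbf{X}_h\times M_h\times Y_h$ such that for all $(\mathbf{v}_h,\mathsf{q}_h,S_h)\in\mathbf{X}_h\times M_h\times Y_h$ $$\int_\Omega(\nu(T_h)\nabla\mathbf{u}_h\cdot\nabla\mathbf{v}_h+\mathbf{u}_h\cdot\mathbf{v}_h)\,\mathrm{d}x+a_{SN}(\mathbf{u}_h;\mathbf{u}_h,\mathbf{v}_h)+\int_\Omega|\mathbf{u}_h|^{s-2}\mathbf{u}_h\cdot\mathbf{v}_h\,\mathrm{d}x-\int_\Omega\mathsf{p}_h\,\mathrm{div}\,\mathbf{v}_h\,\mathrm{d}x=\langle\mathbf{f},\mathbf{v}_h\rangle,$$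 $$\int_\Omega\mathsf{q}_h\,\mathrm{div}\,\mathbf{u}_h\,\mathrm{d}x=0,\qquad\int_\Omega\kappa(T_h)\nabla T_h\cdot\nabla S_h\,\mathrm{d}x+a_{ST}(\mathbf{u}_h;T_h,S_h)=\langle g,S_h\rangle.$$ Constants. $\mathcal{C}_N>0$ is a constant such that $|a_N(\mathbf{u};\mathbf{v},\mathbf{w})|\le\mathcal{C}_N\|\nabla\mathbf{u}\|_{\mathbf{L}^2(\Omega)}\|\nabla\mathbf{v}\|_{\mathbf{L}^2(\Omega)}\|\nabla\mathbf{w}\|_{\mathbf{L}^2(\Omega)}$ on $[\mathbf{H}_0^1(\Omega)]^3$. $\mathcal{C}_{p\hookrightarrow2}$ is the best constant in $\|v\|_{L^p(\Omega)}\le\mathcal{C}_{p\hookrightarrow2}\|\nabla v\|_{\mathbf{L}^2(\Omega)}$ for $v\in H_0^1(\Omega)$; the same symbol is used for vector-valued functions in $\mathbf{H}_0^1(\Omega)$. *)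

(* Defs.v *)
From HB Require Import structures.
From mathcomp Require Import all_boot all_order all_algebra.
From mathcomp Require Import all_classical all_reals all_analysis.
Import Order.TTheory GRing.Theory Num.Theory numFieldNormedType.Exports.

Set Implicit Arguments.
Unset Strict Implicit.
Unset Printing Implicit Defensive.

Local Open Scope classical_set_scope.
Local Open Scope ring_scope.

(* Points of R^3: a type carrying the product measurable structure and the
   product normed-module structure (sup norm, hence the usual topology). *)
Notation pt R :=
  (measurableTypeR R * measurableTypeR R * measurableTypeR R)%type.

Section Euclidean.
Context {R : realType}.

Definition vol : {measure set (pt R) -> \bar R} :=
  ((@lebesgue_measure R \x @lebesgue_measure R) \x @lebesgue_measure R)%E.

Definition coord3 (x : pt R) (i : 'I_3) : R :=
  tnth [tuple (x.1.1 : R); (x.1.2 : R); (x.2 : R)] i.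

Definition unit_vec (i : 'I_3) : pt R :=
  ((i == 0 :> nat)%N%:R : R, (i == 1 :> nat)%N%:R : R, (i == 2 :> nat)%N%:R : R).

Definition dot3 (a b : 'I_3 -> R) : R := \sum_(i < 3) a i * b i.
Definition enorm (a : 'I_3 -> R) : R := Num.sqrt (dot3 a a).
Definition edist (x y : pt R) : R := enorm (coord3 (x - y)).
Definition eball (x : pt R) (r : R) : set (pt R) := [set y | edist x y < r].

End Euclidean.

Section Meshes.
Context {R : realType}.
Implicit Types (K F Omega : set (pt R)) (T : set (set (pt R))).

(* Convex hull of the points [v i], i in A; empty when A is empty. *)
Definition hull (v : 'I_4 -> pt R) (A : {set 'I_4}) : set (pt R) :=
  [set x | exists l : 'I_4 -> R,
    [/\ forall i, 0 <= l i,
        forall i, i \notin A -> l i = 0,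
        \sum_i l i = 1
      & x = \sum_i l i *: v i] ].

Definition affinely_independent (v : 'I_4 -> pt R) : Prop :=
  forall l : 'I_4 -> R,
    \sum_i l i = 0 -> \sum_i l i *: v i = 0 -> forall i, l i = 0.

Definition vertices_of (v : 'I_4 -> pt R) K : Prop :=
  affinely_independent v /\ K = hull v [set: 'I_4].

Definition is_simplex K : Prop := exists v, vertices_of v K.

(* Faces of every dimension, including the empty face and K itself. *)
Definition is_face F K : Prop :=
  exists v A, vertices_of v K /\ F = hull v A.

(* Two simplices meet in a common face, so that distinct simplices
   automatically have disjoint interiors. *)
Definition conforming T : Prop :=
  forall K K', T K -> T K' ->
    is_face (K `&` K') K /\ is_face (K `&` K') K'.

Definition is_mesh Omega T : Prop :=
  [/\ finite_set T,
      forall K, T K -> is_simplex K,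
      \bigcup_(K in T) K = closure Omega
    & conforming T].

Definition refines T T0 : Prop :=
  forall K, T K -> exists2 K0, T0 K0 & K `<=` K0.

Definition diam K : R := sup [set d | exists x y, [/\ K x, K y & d = edist x y] ].
Definition inradius K : R := sup [set r | 0 <= r /\ exists x, eball x r `<=` K].

Definition shape_regular (TT : set (set (set (pt R)))) : Prop :=
  exists sigma : R,
    forall T K, TT T -> T K -> diam K <= sigma * inradius K.

(* The family is given as the set of its members; the parameter h of a member
   T is the maximum of [diam K] over the simplices K of T. *)
Definition mesh_family Omega T0 (TT : set (set (set (pt R)))) : Prop :=
  [/\ is_mesh Omega T0,
      forall T, TT T -> is_mesh Omega T /\ refines T T0
    & shape_regular TT].

(* After a rotation, Omega is locally the epigraph of a Lipschitz function. *)
Definition lipschitz_boundary Omega : Prop :=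
  forall x, (closure Omega `\` interior Omega) x ->
    exists (r : R) (Q : 'M[R]_3) (gamma : R * R -> R),
      let z y k := \sum_(i < 3) coord3 (y - x) i * Q i k in
      [/\ 0 < r,
          Q *m Q^T = 1%:M,
          lipschitz gamma
        & forall y, eball x r y ->
            (Omega y <-> gamma (z y (inord 0), z y (inord 1)) < z y (inord 2))].

Definition polyhedral Omega : Prop :=
  exists P : set (set (pt R)),
    [/\ finite_set P, forall K, P K -> is_simplex K
      & closure Omega = \bigcup_(K in P) K].

Definition lipschitz_polytope Omega : Prop :=
  [/\ open Omega, bounded_set Omega, polyhedral Omega
    & lipschitz_boundary Omega].

End Meshes.

Section Sobolev.
Context {R : realType}.

(* A weakly differentiable function is represented by a representative of the
   function together with a representative of its weak gradient; the membership
   predicates below tie the second field to the first, which determines it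
   almost everywhere. *)
Record sob := Sob { sfun :> pt R -> R; sgrad : 'I_3 -> pt R -> R }.

Implicit Types (Omega : set (pt R)) (v : sob) (u w : 'I_3 -> sob).

Definition eLp Omega (p : R) (f : pt R -> R) : \bar R :=
  'N[vol]_(p%:E)[EFin \o (f \_ Omega)]%E.

Definition inLp Omega (p : R) (f : pt R -> R) : Prop :=
  measurable_fun Omega f /\ (eLp Omega p f < +oo)%E.

Definition Lp_norm Omega (p : R) (f : pt R -> R) : R := fine (eLp Omega p f).

Definition smooth (phi : pt R -> R) : Prop :=
  forall s : seq 'I_3,
    let D := foldr (fun i f => 'D_(unit_vec i) f) phi s in
    continuous D /\ forall i x, derivable D x (unit_vec i).

Definition test_function Omega (phi : pt R -> R) : Prop :=
  let supp := closure [set x | phi x != 0] in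
  [/\ smooth phi, compact supp & supp `<=` Omega].

Definition has_weak_gradient Omega v : Prop :=
  forall phi, test_function Omega phi -> forall i,
    \int[vol]_(x in Omega) (v x * 'D_(unit_vec i) phi x)
    = - \int[vol]_(x in Omega) (sgrad v i x * phi x).

Definition W1p Omega (p : R) v : Prop :=
  [/\ inLp Omega p v, forall i, inLp Omega p (sgrad v i)
    & has_weak_gradient Omega v].

(* The H^1-closure of the test functions. *)
Definition H01 Omega v : Prop :=
  W1p Omega 2 v /\
  exists phi : nat -> pt R -> R,
    [/\ forall n, test_function Omega (phi n),
        (fun n => eLp Omega 2 (fun x => phi n x - v x)) @ \oo --> 0%E
      & forall i,
        (fun n => eLp Omega 2 (fun x => 'D_(unit_vec i) (phi n) x - sgrad v i x))
          @ \oo --> 0%E].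

Definition W1pv Omega (p : R) u : Prop := forall i, W1p Omega p (u i).
Definition H01v Omega u : Prop := forall i, H01 Omega (u i).

Definition at_pt u (x : pt R) : 'I_3 -> R := fun i => u i x.
Definition grad v (x : pt R) : 'I_3 -> R := fun j => sgrad v j x.
Definition ddot u w (x : pt R) : R :=
  \sum_(i < 3) dot3 (grad (u i) x) (grad (w i) x).
Definition div u (x : pt R) : R := \sum_(i < 3) sgrad (u i) i x.

Definition grad_norm Omega (p : R) v : R :=
  Lp_norm Omega p (fun x => enorm (grad v x)).
Definition gradv_norm Omega (p : R) u : R :=
  Lp_norm Omega p (fun x => Num.sqrt (ddot u u x)).

Definition Hm1 Omega (g : (pt R -> R) -> R) : Prop :=
  (forall (a : R) v v', H01 Omega v -> H01 Omega v' ->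
     g (fun x => a * v x + v' x) = a * g v + g v') /\
  (exists C : R, forall v, H01 Omega v -> `|g v| <= C * grad_norm Omega 2 v).

Definition Hm1_norm Omega (g : (pt R -> R) -> R) : R :=
  sup [set `|g v| / grad_norm Omega 2 v
      | v in [set v | H01 Omega v /\ grad_norm Omega 2 v != 0] ].

Definition Hm1v Omega (f : ('I_3 -> pt R -> R) -> R) : Prop :=
  (forall (a : R) u w, H01v Omega u -> H01v Omega w ->
     f (fun i x => a * u i x + w i x) = a * f u + f w) /\
  (exists C : R, forall u, H01v Omega u -> `|f u| <= C * gradv_norm Omega 2 u).

Definition Hm1v_norm Omega (f : ('I_3 -> pt R -> R) -> R) : R :=
  sup [set `|f u| / gradv_norm Omega 2 u
      | u in [set u | H01v Omega u /\ gradv_norm Omega 2 u != 0] ].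

Definition embedding_bound Omega (p C : R) : Prop :=
  forall v, H01 Omega v -> (eLp Omega p v <= (C * grad_norm Omega 2 v)%:E)%E.

Definition best_embedding_constant Omega (p C : R) : Prop :=
  embedding_bound Omega p C /\
  forall C', embedding_bound Omega p C' -> C <= C'.

End Sobolev.
Arguments sob R : clear implicits.

Section FiniteElements.
Context {R : realType}.
Implicit Types (Omega K : set (pt R)) (T : set (set (pt R))).

(* Polynomials of total degree at most k. *)
Definition is_poly (k : nat) (p : pt R -> R) : Prop :=
  exists c : nat -> nat -> nat -> R, forall x : pt R,
    p x = \sum_(i < k.+1) \sum_(j < k.+1) \sum_(l < k.+1 | (i + j + l <= k)%N)
            c i j l * (coord3 x (inord 0) ^+ i * coord3 x (inord 1) ^+ j
                       * coord3 x (inord 2) ^+ l).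

Definition poly_on (k : nat) K (f : pt R -> R) : Prop :=
  exists2 p, is_poly k p & forall x, K x -> f x = p x.

Definition local_bubble K (b : pt R -> R) : Prop :=
  [/\ {within K, continuous b},
      forall x, interior K x -> 0 < b x,
      forall x, (K `\` interior K) x -> b x = 0
    & exists G, H01 (interior K) (Sob b G)].

(* The argument of [Mini] gives, for each simplex, its local bubble function. *)
Inductive fe_pair := TaylorHood | Mini of (set (pt R) -> pt R -> R).

Definition fe_admissible (fe : fe_pair) (TT : set (set (set (pt R)))) : Prop :=
  match fe with
  | TaylorHood => True
  | Mini b => forall T K, TT T -> T K -> local_bubble K (b K)
  end.

Definition velocity_local (fe : fe_pair) K (f : pt R -> R) : Prop :=
  match fe with
  | TaylorHood => poly_on 2 K f
  | Mini b => exists (p : pt R -> R) (c : R),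
      is_poly 1 p /\ forall x, K x -> f x = p x + c * b K x
  end.

Definition temperature_degree (fe : fe_pair) : nat :=
  match fe with TaylorHood => 2 | Mini _ => 1 end.

Definition Xh Omega (fe : fe_pair) T (u : 'I_3 -> sob R) : Prop :=
  forall i, [/\ {within closure Omega, continuous (u i : pt R -> R)},
                forall K, T K -> velocity_local fe K (u i)
              & H01 Omega (u i)].

Definition Mh Omega T (q : pt R -> R) : Prop :=
  [/\ inLp Omega 2 q,
      \int[vol]_(x in Omega) q x = 0,
      {within closure Omega, continuous q}
    & forall K, T K -> poly_on 1 K q].

Definition Yh Omega (fe : fe_pair) T (S : sob R) : Prop :=
  [/\ {within closure Omega, continuous (S : pt R -> R)},
      forall K, T K -> poly_on (temperature_degree fe) K S
    & H01 Omega S].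

Definition infsup Omega (fe : fe_pair) T : \bar R :=
  ereal_inf
    [set ereal_sup
       [set (\int[vol]_(x in Omega) (q x * div v x)
             / (gradv_norm Omega 2 v * Lp_norm Omega 2 q))%:E
       | v in [set v | Xh Omega fe T v /\ exists i x, Omega x /\ v i x != 0] ]
    | q in [set q | Mh Omega T q /\ exists x, Omega x /\ q x != 0] ].

Definition uniform_infsup Omega fe (TT : set (set (set (pt R)))) : Prop :=
  exists2 beta : R, 0 < beta &
    forall T, TT T -> (beta%:E <= infsup Omega fe T)%E.

End FiniteElements.
Arguments fe_pair R : clear implicits.

Section CoupledProblem.
Context {R : realType}.
Context (Omega : set (pt R)).
Implicit Types (u v w : 'I_3 -> sob R) (T S : sob R).

Definition aN u v w : R :=
  \int[vol]_(x in Omega) \sum_(i < 3) dot3 (at_pt u x) (grad (v i) x) * w i x.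

Definition aSN u v w : R := 2^-1 * (aN u v w - aN u w v).

Definition aST v T S : R :=
  2^-1 * \int[vol]_(x in Omega)
    (dot3 (at_pt v x) (grad T x) * S x - dot3 (at_pt v x) (grad S x) * T x).

Definition convection_constant (C : R) : Prop :=
  0 < C /\
  forall u v w, H01v Omega u -> H01v Omega v -> H01v Omega w ->
    `|aN u v w| <=
      C * gradv_norm Omega 2 u * gradv_norm Omega 2 v * gradv_norm Omega 2 w.

Definition discrete_solution (fe : fe_pair R) (Th : set (set (pt R)))
    (nu kappa : R -> R) (s : R)
    (f : ('I_3 -> pt R -> R) -> R) (g : (pt R -> R) -> R)
    u (p : pt R -> R) T : Prop :=
  [/\ Xh Omega fe Th u, Mh Omega Th p & Yh Omega fe Th T] /\
  forall v q S, Xh Omega fe Th v -> Mh Omega Th q -> Yh Omega fe Th S ->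
    [/\ \int[vol]_(x in Omega)
            (nu (T x) * ddot u v x + dot3 (at_pt u x) (at_pt v x))
          + aSN u u v
          + \int[vol]_(x in Omega)
              (enorm (at_pt u x) `^ (s - 2) * dot3 (at_pt u x) (at_pt v x))
          - \int[vol]_(x in Omega) (p x * div v x)
        = f v,
        \int[vol]_(x in Omega) (q x * div u x) = 0
      & \int[vol]_(x in Omega) (kappa (T x) * dot3 (grad T x) (grad S x))
          + aST u T S
        = g S].

End CoupledProblem.

(* Main.v *)
Require Import Defs.
From HB Require Import structures.
From mathcomp Require Import all_boot all_order all_algebra.
From mathcomp Require Import all_classical all_reals all_analysis.
From mathcomp Require Import measurable_realfun ring lra.
Import Order.TTheory GRing.Theory Num.Theory numFieldNormedType.Exports.

Set Implicit Arguments.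
Unset Strict Implicit.
Unset Printing Implicit Defensive.

Local Open Scope classical_set_scope.
Local Open Scope ring_scope.

(** Let e = u1 - u2 and E = T1 - T2, which lie again in the discrete spaces. The
    discrete velocities and temperatures are continuous on the compact closure
    of Omega, hence bounded. A product of bounded functions with at most two
    square-integrable ones is integrable, so every integral in the problem
    converges and the two sets of equations can be subtracted.

    Test the difference of the temperature equations with E and write
    kappa(T1) grad T1 - kappa(T2) grad T2
      = kappa(T2) grad E + (kappa(T1) - kappa(T2)) grad T1.
    The first part is coercive, and the second is bounded by the exponents 6, 3
    and 2 (diffusion_difference). The transport by u2 disappears by skew
    symmetry, and the transport of T1 by e is bounded by the exponents 4, 4 and
    2. Hence |grad E| is at most a multiple of |grad e| (temperature_stability).

    Test the difference of the momentum equations with e. The pressures drop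
    out because e is discretely divergence free, the power term has a sign
    because v -> |v|^(s-2) v is monotone (power_field_monotone), and the viscous
    and convective terms are treated as before (momentum_stability). Testing
    each equation with its own solution bounds |grad u1| and |grad T1| by the
    data. Together this gives nu_min |grad e|^2 <= theta nu_min |grad e|^2,
    where theta < 1 is the left-hand side of the smallness assumption
    (smallness_forces_zero). So both differences vanish almost everywhere, and
    by continuity on the whole closure (continuous_ae0).

    Now p1 - p2 is orthogonal to the divergence of every discrete velocity
    (pressure_orthogonal), so the inf-sup condition makes it zero
    (infsup_orthogonal_eq0). *)

(** * Open sets and continuous functions in three-dimensional space *)

Section Space.
Context {R : realType}.
Implicit Types (U Omega : set (pt R)) (f : pt R -> R).

Lemma ball_ptE (q : pt R) (r : R) :
  ball q r = (ball q.1.1 r `*` ball q.1.2 r) `*` ball q.2 r.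
Proof.
by apply/seteqP; split => [x [[a b] c]|x [[a b] c]].
Qed.

Lemma measurable_ball_pt (q : pt R) (r : R) : measurable (ball q r).
Proof.
rewrite ball_ptE; apply: measurableX; last exact: measurable_ball.
by apply: measurableX; exact: measurable_ball.
Qed.

Lemma vol_ball (q : pt R) (r : R) : 0 <= r ->
  vol (ball q r) = ((r *+ 2) * (r *+ 2) * (r *+ 2))%:E.
Proof.
move=> r0; rewrite ball_ptE.
have mb y : measurable (ball y r : set (measurableTypeR R)).
  exact: measurable_ball.
etransitivity.
  by apply: product_measure1E => //; apply: measurableX.
have lb (y : R) : @lebesgue_measure R (ball y r) = (r *+ 2)%:E.
  exact: lebesgue_measure_ball.
rewrite [X in (_ * X)%E]lb.
by rewrite [X in (X * _)%E]product_measure1E//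
  [X in ((X * _) * _)%E]lb [X in ((_ * X) * _)%E]lb.
Qed.

(** Every point of an open set lies in a ball with rational center and radius
    inside the set, and there are countably many of these. *)
Lemma open_measurable_pt U : open U -> measurable U.
Proof.
move=> oU.
pose B (i : (rat * rat * rat) * rat) : set (pt R) :=
  ball ((ratr i.1.1.1, ratr i.1.1.2, ratr i.1.2) : pt R) (ratr i.2).
have -> : U = \bigcup_i (if asbool (B i `<=` U) then B i else set0).
  apply/seteqP; split => [x Ux|x [i _]]; last by case: asboolP => // BU /BU.
  have /nbhs_ballP[e /= e0 xe] : nbhs x U by exact: open_nbhs_nbhs.
  (* Half the radius, so that a center within r of x leaves its r-ball in U. *)
  have [r] := @rat_in_itvoo R 0 (e / 2) ltac:(by rewrite divr_gt0).
  rewrite in_itv /= => /andP[r0 re].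
  have close (y : R) : exists q : rat, `|ratr q - y| < ratr r.
    have [q] := @rat_in_itvoo R (y - ratr r) (y + ratr r) ltac:(lra).
    rewrite in_itv /= => /andP[q1 q2]; exists q; rewrite ltr_norml; lra.
  have [a ha] := close x.1.1; have [b hb] := close x.1.2.
  have [c hc] := close x.2.
  exists ((a, b, c), r) => //; case: asboolP => [_|]; first by [].
  case => y [[y1 y2] y3]; apply: xe; move: y1 y2 y3.
  rewrite /B /ball /= /ball_ => y1 y2 y3.
  move: ha hb hc y1 y2 y3; rewrite !ltr_norml => ha hb hc y1 y2 y3.
  by split; [split|]; rewrite /= /ball /= /ball_ ltr_norml; lra.
apply: countable_bigcupT_measurable => [|i]; first exact: countableP.
by case: asboolP => // _; exact: measurable_ball_pt.
Qed.

Lemma vol_open_gt0 U x : open U -> U x -> (0 < vol U)%E.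
Proof.
move=> oU Ux.
have /nbhs_ballP[e /= e0 xe] : nbhs x U by exact: open_nbhs_nbhs.
apply: (@lt_le_trans _ _ (vol (ball x e))).
  by rewrite vol_ball ?ltW// lte_fin !mulr_gt0// pmulrn_lgt0.
apply: le_measure; rewrite ?inE//; first exact: measurable_ball_pt.
exact: open_measurable_pt.
Qed.

Lemma bounded_sub_ball Omega : bounded_set Omega ->
  exists2 r : R, 0 < r & Omega `<=` ball (0 : pt R) r.
Proof.
move=> /ex_strict_bound_gt0[M M0 OM]; exists M => // x /OM /=.
by rewrite -ball_normE /= /ball_ sub0r normrN.
Qed.

Lemma bounded_vol_fin Omega : bounded_set Omega -> measurable Omega ->
  (vol Omega < +oo)%E.
Proof.
move=> /bounded_sub_ball[r r0 Or] mO.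
apply: (@le_lt_trans _ _ (vol (ball (0 : pt R) r))).
  by apply: le_measure; rewrite ?inE//; exact: measurable_ball_pt.
by rewrite vol_ball ?ltW// ltry.
Qed.

Lemma bounded_closure_compact Omega : bounded_set Omega ->
  compact (closure Omega).
Proof.
move=> /bounded_sub_ball[r r0 Or].
pose I := [set` `[(- r)%R, r]].
have cI : compact I by exact: segment_compact.
apply: (@subclosed_compact _ _ ((I `*` I) `*` I)).
- exact: closed_closure.
- by apply: compact_setX => //; exact: compact_setX.
have cB : closed ((I `*` I) `*` I).
  apply: compact_closed; last by apply: compact_setX => //; exact: compact_setX.
  exact: norm_hausdorff.
have OI : Omega `<=` (I `*` I) `*` I.
  move=> x /Or [[a b] c]; move: a b c; rewrite /ball /= /ball_ !sub0r !normrN.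
  by move=> /ltW a /ltW b /ltW c; split; [split|]; rewrite /I /= in_itv /= -ler_norml.
by move=> x /(closure_subset OI); rewrite -(closure_id _).1.
Qed.

Lemma continuous_measurable_pt Omega f : open Omega ->
  {within closure Omega, continuous f} -> measurable_fun Omega f.
Proof.
move=> oO /(continuous_subspaceW (@subset_closure _ Omega)) /continuousP cf.
apply: (measurability _ (RGenOpens.measurableE R)).
move=> _ [_ [a [b ->] <-]].
have /open_subspaceP[V oV VE] := cf _ (@interval_open _ (BRight a) (BLeft b) isT isT).
by rewrite setIC -VE; apply: open_measurable_pt; exact: openI.
Qed.

(** The closure of a bounded set is compact. *)
Lemma continuous_bounded_pt Omega f : bounded_set Omega ->
  {within closure Omega, continuous f} ->
  exists M : R, forall x, Omega x -> `|f x| <= M.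
Proof.
move=> bO cf; have cO := bounded_closure_compact bO.
have /compact_bounded/pinfty_ex_gt0[M _ fM] := continuous_compact cf cO.
by exists M => x /subset_closure cOx; apply: fM; exists x.
Qed.

(** Near a point of the closure where f does not vanish there is a nonempty
    open part of Omega on which f does not vanish, of positive volume. *)
Lemma continuous_ae0 Omega f : open Omega ->
  {within closure Omega, continuous f} ->
  {ae vol, forall x, Omega x -> f x = 0} ->
  forall x, closure Omega x -> f x = 0.
Proof.
move=> oO /continuousP cf [N [mN N0 fN]] x cOx; apply: contrapT => /eqP fx0.
have /open_subspaceP[V oV VE] := cf _ (@open_neq R 0).
have Vx : V x by have [] : (V `&` closure Omega) x by rewrite VE.
have [y [Oy Vy]] := cOx V (open_nbhs_nbhs (conj oV Vx)).
have oOV : open (Omega `&` V) by exact: openI.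
have OVN : Omega `&` V `<=` N.
  move=> z [Oz Vz]; apply: fN => /(_ Oz) fz0.
  have [] : ((f @^-1` [set y | y != 0]) `&` closure Omega) z.
    by rewrite -VE; split => //; exact: subset_closure.
  by rewrite /= fz0 eqxx.
have := vol_open_gt0 oOV (conj Oy Vy).
rewrite ltNge => /negP; apply; rewrite -N0.
by apply: le_measure; rewrite ?inE//; exact: open_measurable_pt.
Qed.

End Space.

(** * Euclidean inequalities *)

Section Algebra.
Context {R : realType}.

(** With B the squared length of b and C the inner product, the squared
    length of B a - C b is B (A B - C^2). *)
Lemma sum_cauchy_schwarz (I : finType) (a b : I -> R) :
  `|\sum_i a i * b i|
    <= Num.sqrt (\sum_i a i * a i) * Num.sqrt (\sum_i b i * b i).
Proof.
set C := \sum_i a i * b i; set A := \sum_i a i * a i; set B := \sum_i b i * b i.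
have A0 : 0 <= A by apply: sumr_ge0 => i _; rewrite -expr2 sqr_ge0.
have B0 : 0 <= B by apply: sumr_ge0 => i _; rewrite -expr2 sqr_ge0.
rewrite -sqrtrM// -sqrtr_sqr ler_sqrt ?mulr_ge0//.
have [B_eq0|B_neq0] := eqVneq B 0.
  have b0 i : b i = 0.
    apply/eqP; rewrite -sqrf_eq0 expr2; apply/eqP.
    by apply: (psumr_eq0P _ B_eq0) => // j _; rewrite -expr2 sqr_ge0.
  by rewrite /C big1 ?expr0n ?mulr_ge0// => i _; rewrite b0 mulr0.
have Bgt0 : 0 < B by rewrite lt_def B_neq0.
have : 0 <= \sum_i (B * a i - C * b i) ^+ 2 by apply: sumr_ge0 => i _; exact: sqr_ge0.
have -> : \sum_i (B * a i - C * b i) ^+ 2 = B * (A * B - C ^+ 2).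
  transitivity (\sum_i (B ^+ 2 * (a i * a i) - 2 * B * C * (a i * b i)
                        + C ^+ 2 * (b i * b i))).
    by apply: eq_bigr => i _; ring.
  by rewrite big_split /= sumrB -!mulr_sumr -/A -/B -/C; ring.
by rewrite pmulr_rge0// subr_ge0.
Qed.

Implicit Types a b c : 'I_3 -> R.

Lemma dot3C a b : dot3 a b = dot3 b a.
Proof. by apply: eq_bigr => i _; rewrite mulrC. Qed.

Lemma dot3Bl a b c : dot3 (fun i => a i - b i) c = dot3 a c - dot3 b c.
Proof. by rewrite -sumrB; apply: eq_bigr => i _; rewrite mulrBl. Qed.

Lemma dot3Br a b c : dot3 a (fun i => b i - c i) = dot3 a b - dot3 a c.
Proof. by rewrite dot3C dot3Bl ![dot3 a _]dot3C. Qed.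

Lemma dot3_ge0 a : 0 <= dot3 a a.
Proof. by apply: sumr_ge0 => i _; rewrite -expr2 sqr_ge0. Qed.

Lemma enorm_ge0 a : 0 <= enorm a. Proof. exact: sqrtr_ge0. Qed.

Lemma enorm_sqr a : enorm a ^+ 2 = dot3 a a.
Proof. by rewrite sqr_sqrtr ?dot3_ge0. Qed.

Lemma dot3_cauchy_schwarz a b : `|dot3 a b| <= enorm a * enorm b.
Proof. exact: sum_cauchy_schwarz. Qed.

(** Since the inner product of a and b is at most |a| |b|, the expression
    dominates (|a|^m |a| - |b|^m |b|) (|a| - |b|). *)
Lemma power_field_monotone (m : R) a b : 0 <= m ->
  0 <= enorm a `^ m * dot3 a (fun i => a i - b i)
       - enorm b `^ m * dot3 b (fun i => a i - b i).
Proof.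
move=> m0; rewrite !dot3Br -!enorm_sqr (dot3C b a).
set x := enorm a; set y := enorm b.
have x0 : 0 <= x by exact: enorm_ge0.
have y0 : 0 <= y by exact: enorm_ge0.
have ax : 0 <= x `^ m by exact: powR_ge0.
have ay : 0 <= y `^ m by exact: powR_ge0.
have ab : dot3 a b <= x * y.
  by rewrite (le_trans (ler_norm _))// dot3_cauchy_schwarz.
have /le_trans -> // : 0 <= (x `^ m * x - y `^ m * y) * (x - y).
  have [xy|/ltW yx] := leP x y.
    rewrite mulr_le0 ?subr_le0// ler_pM//.
    by apply: ge0_ler_powR => //; rewrite nnegrE.
  rewrite mulr_ge0 ?subr_ge0// ler_pM//.
  by apply: ge0_ler_powR => //; rewrite nnegrE.
by nra.
Qed.

Lemma ddotE (u w : 'I_3 -> sob R) x :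
  ddot u w x = \sum_(p : 'I_3 * 'I_3) sgrad (u p.1) p.2 x * sgrad (w p.1) p.2 x.
Proof. by rewrite /ddot /dot3 pair_big. Qed.

End Algebra.

(** * Lebesgue norms on a measurable set *)

Section LebesgueNorms.
Context {R : realType} (Omega : set (pt R)).
Hypothesis mO : measurable Omega.
Implicit Types (f g h : pt R -> R) (p q r : R).

Lemma poweR_inj (x y : \bar R) p : p != 0 -> (0 <= x)%E -> (0 <= y)%E ->
  (x `^ p = y `^ p)%E -> x = y.
Proof.
move=> p0 x0 y0 /(congr1 (fun z => (z `^ p^-1)%E)).
by rewrite -!poweRrM divff// !poweRe1.
Qed.

Lemma poweR_le_inv (x y : \bar R) p : 0 < p -> (0 <= x)%E -> (0 <= y)%E ->
  (x `^ p <= y `^ p)%E -> (x <= y)%E.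
Proof.
move=> p0 x0 y0 xy.
have /gt0_ler_poweR : 0 <= p^-1 by rewrite invr_ge0 ltW.
move=> /(_ (x `^ p)%E (y `^ p)%E).
rewrite !in_itv /= !leey !poweR_ge0 -!poweRrM divff ?gt_eqF// !poweRe1//.
by move=> /(_ isT isT xy).
Qed.

Lemma eLp_ge0 p f : (0 <= eLp Omega p f)%E.
Proof. exact: Lnorm_ge0. Qed.

Lemma Lp_norm_ge0 p f : 0 <= Lp_norm Omega p f.
Proof. exact/fine_ge0/eLp_ge0. Qed.

(** The extension by zero in the norm does not change the integral over
    Omega because 0 to a positive power is 0. *)
Lemma eLp_poweR p f : 0 < p ->
  (eLp Omega p f `^ p = \int[vol]_(x in Omega) (`|f x| `^ p)%:E)%E.
Proof.
move=> p0; rewrite /eLp poweR_Lnorm; last by rewrite gt_eqF.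
rewrite [RHS]integral_mkcond.
apply: eq_integral => x _; rewrite /patch /=.
case: ifP => _; rewrite -?poweR_EFin//.
rewrite (_ : point = 0 :> R)// (_ : point = 0 :> \bar R)//.
by rewrite poweR_EFin normr0 powR0// gt_eqF.
Qed.

Lemma eq_eLp p f g : (forall x, Omega x -> f x = g x) ->
  eLp Omega p f = eLp Omega p g.
Proof.
move=> fg; apply: eq_Lnorm => x /=; rewrite /patch; case: ifPn => //.
by rewrite inE => Ox; rewrite fg.
Qed.

Lemma measurable_powR_norm p f : measurable_fun Omega f ->
  measurable_fun Omega (fun x => `|f x| `^ p).
Proof.
move=> mf; apply: (measurableT_comp (measurable_powR p)).
exact: measurableT_comp.
Qed.

Lemma eLp_norm_powR p r f : 0 < p -> 0 < r ->
  eLp Omega p (fun x => `|f x| `^ r) = (eLp Omega (p * r) f `^ r)%E.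
Proof.
move=> p0 r0; apply: (@poweR_inj _ _ p); rewrite ?gt_eqF ?eLp_ge0 ?poweR_ge0//.
have pr0 : 0 < p * r by exact: mulr_gt0.
rewrite -poweRrM (mulrC r) (eLp_poweR _ p0) (eLp_poweR _ pr0).
apply: eq_integral => x _; rewrite ger0_norm ?powR_ge0//.
by rewrite -powRrM (mulrC r).
Qed.

Lemma eLp_hoelder1 p q f g :
  measurable_fun Omega f -> measurable_fun Omega g ->
  0 < p -> 0 < q -> p^-1 + q^-1 = 1 ->
  (eLp Omega 1 (fun x => (f x * g x)%R) <= eLp Omega p f * eLp Omega q g)%E.
Proof.
move=> mf mg p0 q0 pq.
have /= := @hoelder _ _ _ vol (f \_ Omega) (g \_ Omega) p q
  ((measurable_restrictT _ mO).1 mf) ((measurable_restrictT _ mO).1 mg) p0 q0 pq.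
apply: le_trans; rewrite le_eqVlt; apply/orP; left; apply/eqP.
apply: eq_Lnorm => x /=; rewrite /patch; case: ifP => //.
by rewrite mulr0.
Qed.

(** This is the classical inequality for the powers |f|^r and |g|^r, whose
    exponents p/r and q/r are conjugate. *)
Lemma eLp_hoelder p q r f g :
  measurable_fun Omega f -> measurable_fun Omega g ->
  0 < p -> 0 < q -> 0 < r -> p^-1 + q^-1 = r^-1 ->
  (eLp Omega r (fun x => (f x * g x)%R) <= eLp Omega p f * eLp Omega q g)%E.
Proof.
move=> mf mg p0 q0 r0 pqr.
apply: (@poweR_le_inv _ _ r); rewrite ?mule_ge0 ?eLp_ge0//.
rewrite poweRM ?eLp_ge0//.
have powE t h : 0 < t ->
    (eLp Omega t h `^ r)%E = eLp Omega (t / r) (fun x => `|h x| `^ r).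
  by move=> t0; rewrite eLp_norm_powR ?divr_gt0// mulfVK// gt_eqF.
rewrite !powE// divff ?gt_eqF//.
have := @eLp_hoelder1 (p / r) (q / r) _ _ (measurable_powR_norm r mf)
  (measurable_powR_norm r mg).
rewrite !divr_gt0// => /(_ isT isT).
rewrite !invf_div -mulrDr pqr divff ?gt_eqF// => /(_ erefl).
apply: le_trans; rewrite le_eqVlt; apply/orP; left; apply/eqP/eq_eLp => x _.
by rewrite normrM powRM.
Qed.

Lemma eLpD p f g : 1 <= p ->
  measurable_fun Omega f -> measurable_fun Omega g ->
  (eLp Omega p (fun x => (f x + g x)%R) <= eLp Omega p f + eLp Omega p g)%E.
Proof.
move=> p1 mf mg.
have /= := @minkowski_EFin _ _ _ vol (f \_ Omega) (g \_ Omega) p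
  ((measurable_restrictT _ mO).1 mf) ((measurable_restrictT _ mO).1 mg) p1.
apply: le_trans; rewrite le_eqVlt; apply/orP; left; apply/eqP.
apply: eq_Lnorm => x /=; rewrite /patch; case: ifP => //.
by rewrite addr0.
Qed.

Lemma eLpN p f : 0 < p -> eLp Omega p (fun x => - f x) = eLp Omega p f.
Proof.
move=> p0; apply: (@poweR_inj _ _ p); rewrite ?gt_eqF ?eLp_ge0//.
by rewrite !(eLp_poweR _ p0); apply: eq_integral => x _; rewrite normrN.
Qed.

Lemma eLpB p f g : 1 <= p ->
  measurable_fun Omega f -> measurable_fun Omega g ->
  (eLp Omega p (fun x => (f x - g x)%R) <= eLp Omega p f + eLp Omega p g)%E.
Proof.
move=> p1 mf mg; rewrite -(@eLpN p g) ?(lt_le_trans ltr01)//.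
by apply: eLpD => //; exact: measurableT_comp.
Qed.

Lemma inLpB p f g : 1 <= p -> inLp Omega p f -> inLp Omega p g ->
  inLp Omega p (fun x => f x - g x).
Proof.
move=> p1 [mf lf] [mg lg]; split; first exact: measurable_funB.
by apply: le_lt_trans (eLpB p1 mf mg) _; exact: lte_add_pinfty.
Qed.

Lemma inLpD p f g : 1 <= p -> inLp Omega p f -> inLp Omega p g ->
  inLp Omega p (fun x => f x + g x).
Proof.
move=> p1 [mf lf] [mg lg]; split; first exact: measurable_funD.
by apply: le_lt_trans (eLpD p1 mf mg) _; exact: lte_add_pinfty.
Qed.

Lemma inLp0 p : 0 < p -> inLp Omega p (fun=> 0).
Proof.
move=> p0; split; first exact: measurable_cst.
apply: (@lty_poweRy _ _ p); rewrite ?gt_eqF// (eLp_poweR _ p0).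
by under eq_integral do rewrite normr0 powR0 ?gt_eqF//; rewrite integral0.
Qed.

Lemma inLp_sum (I : Type) (s : seq I) p (F : I -> pt R -> R) : 1 <= p ->
  (forall i, inLp Omega p (F i)) -> inLp Omega p (fun x => \sum_(i <- s) F i x).
Proof.
move=> p1 FL; elim: s => [|i s IH].
  under eq_fun do rewrite big_nil; apply: inLp0; exact: lt_le_trans ltr01 p1.
by under eq_fun do rewrite big_cons; exact: inLpD.
Qed.

Lemma inLp_dom (M : R) p f g : 0 < p -> measurable_fun Omega f ->
  (forall x, Omega x -> `|f x| <= M * `|g x|) -> inLp Omega p g ->
  inLp Omega p f.
Proof.
move=> p0 mf fg [mg lg]; split => //.
have M0 x : Omega x -> 0 <= M * `|g x| by move=> /fg; exact: le_trans.
apply: (@lty_poweRy _ _ p); rewrite ?gt_eqF// (eLp_poweR _ p0).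
have mp h : measurable_fun Omega h ->
    measurable_fun Omega (fun x => (`|h x| `^ p)%:E).
  by move=> mh; apply/measurable_EFinP; exact: measurable_powR_norm.
apply: (@le_lt_trans _ _
    (\int[vol]_(x in Omega) ((`|M| `^ p)%:E * (`|g x| `^ p)%:E))%E).
  apply: ge0_le_integral => //.
  - exact: mp.
  - by apply: emeasurable_funM; [exact: measurable_cst|exact: mp].
  move=> x Ox; rewrite -EFinM lee_fin -powRM// ge0_ler_powR ?nnegrE//; first exact: ltW.
  by rewrite -normrM (le_trans (fg _ Ox))// (le_trans (ler_norm _))// !normrM normr_id.
rewrite ge0_integralZl//; last exact: mp.
by rewrite lte_mul_pinfty// -eLp_poweR// poweR_lty.
Qed.

Lemma inLp_mul p q r f g : 0 < p -> 0 < q -> 0 < r -> p^-1 + q^-1 = r^-1 ->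
  inLp Omega p f -> inLp Omega q g -> inLp Omega r (fun x => f x * g x).
Proof.
move=> p0 q0 r0 pqr [mf lf] [mg lg]; split; first exact: measurable_funM.
apply: le_lt_trans (eLp_hoelder mf mg p0 q0 r0 pqr) _.
by rewrite lte_mul_pinfty ?eLp_ge0// ge0_fin_numE ?eLp_ge0.
Qed.

Lemma eLp1 f : (eLp Omega 1 f = \int[vol]_(x in Omega) `|f x|%:E)%E.
Proof.
rewrite -[LHS]poweRe1 ?eLp_ge0// (eLp_poweR _ ltr01).
by apply: eq_integral => x _; rewrite powRr1.
Qed.

Lemma inLp1_integrable f :
  inLp Omega 1 f <-> vol.-integrable Omega (EFin \o f).
Proof.
split => [[mf lf]|/integrableP[mf lf]].
  by apply/integrableP; split; [exact/measurable_EFinP|rewrite -eLp1].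
by split; [exact/measurable_EFinP|rewrite eLp1].
Qed.

Lemma Lp_normE p f : inLp Omega p f -> (Lp_norm Omega p f)%:E = eLp Omega p f.
Proof. by move=> [_ lf]; rewrite fineK// ge0_fin_numE ?eLp_ge0. Qed.

Lemma Rintegral_le_Lp_norm1 f : inLp Omega 1 f ->
  `|\int[vol]_(x in Omega) f x| <= Lp_norm Omega 1 f.
Proof.
move=> /inLp1_integrable fi.
rewrite /Lp_norm eLp1; exact: le_normr_Rintegral.
Qed.

Lemma Lp_norm_hoelder p q r f g : 0 < p -> 0 < q -> 0 < r ->
  p^-1 + q^-1 = r^-1 -> inLp Omega p f -> inLp Omega q g ->
  Lp_norm Omega r (fun x => f x * g x) <= Lp_norm Omega p f * Lp_norm Omega q g.
Proof.
move=> p0 q0 r0 pqr fL gL.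
rewrite -lee_fin EFinM !Lp_normE//; last exact: inLp_mul fL gL.
by apply: eLp_hoelder => //; [case: fL|case: gL].
Qed.

Lemma Lp_norm2_sqr f : inLp Omega 2 f ->
  Lp_norm Omega 2 f ^+ 2 = \int[vol]_(x in Omega) (f x * f x).
Proof.
move=> fL; rewrite -powR_mulrn ?Lp_norm_ge0// /Lp_norm -fine_poweR.
rewrite (eLp_poweR _ (ltr0n _ 2)).
congr fine; apply: eq_integral => x _.
by rewrite powR_mulrn// -normrX ger0_norm ?sqr_ge0.
Qed.

(** Cauchy--Schwarz separates h from the product f g, which lies in L^2. *)
Lemma Rintegral_hoelder3 p q f g h : 0 < p -> 0 < q -> p^-1 + q^-1 = 2^-1 ->
  inLp Omega p f -> inLp Omega q g -> inLp Omega 2 h ->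
  inLp Omega 1 (fun x => f x * g x * h x) /\
  `|\int[vol]_(x in Omega) (f x * g x * h x)|
    <= Lp_norm Omega p f * Lp_norm Omega q g * Lp_norm Omega 2 h.
Proof.
move=> p0 q0 pq fL gL hL.
have fgL : inLp Omega 2 (fun x => f x * g x) by exact: inLp_mul fL gL.
have e2 : (2^-1 + 2^-1 = 1^-1 :> R) by rewrite invr1; lra.
have iL : inLp Omega 1 (fun x => f x * g x * h x) by exact: inLp_mul fgL hL.
split => //; apply: le_trans (Rintegral_le_Lp_norm1 iL) _.
apply: le_trans (Lp_norm_hoelder _ _ _ e2 fgL hL) _ => //.
by rewrite ler_wpM2r ?Lp_norm_ge0// Lp_norm_hoelder.
Qed.

End LebesgueNorms.

(** * Differences of discrete functions *)

Section Differences.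
Context {R : realType} (Omega : set (pt R)).
Hypothesis oO : open Omega.
Hypothesis bO : bounded_set Omega.

Let mO : measurable Omega. Proof. exact: open_measurable_pt. Qed.

Definition sobB (v w : sob R) : sob R :=
  Sob (fun x => v x - w x) (fun i x => sgrad v i x - sgrad w i x).

Definition vecB (u w : 'I_3 -> sob R) : 'I_3 -> sob R :=
  fun i => sobB (u i) (w i).

Lemma inLp_bounded (p M : R) (f : pt R -> R) : 0 < p ->
  measurable_fun Omega f -> (forall x, Omega x -> `|f x| <= M) ->
  inLp Omega p f.
Proof.
move=> p0 mf fM; apply: (@inLp_dom _ _ mO M p f (fun=> 1)) => //.
  by move=> x Ox; rewrite normr1 mulr1 fM.
split; first exact: measurable_cst.
apply: (@lty_poweRy _ _ p); rewrite ?gt_eqF// (eLp_poweR _ _ p0).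
under eq_integral do rewrite normr1 powR1.
by rewrite integral_cst// mul1e; exact: bounded_vol_fin.
Qed.

Lemma inLp_continuous (p : R) (f : pt R -> R) : 0 < p ->
  {within closure Omega, continuous f} -> inLp Omega p f.
Proof.
move=> p0 cf; have [M fM] := continuous_bounded_pt bO cf.
by apply: inLp_bounded fM => //; exact: continuous_measurable_pt.
Qed.

(** Omega has finite volume, so the constant 1 is square integrable. *)
Lemma inLp2_inLp1 (f : pt R -> R) : inLp Omega 2 f -> inLp Omega 1 f.
Proof.
move=> f2; have -> : f = (fun x => f x * 1) by apply/funext => x; rewrite mulr1.
apply: (@inLp_mul _ _ mO 2 2 1) => //; first by rewrite invr1; lra.
by apply: (@inLp_bounded _ 1) => // x _; rewrite normr1.
Qed.

Lemma inLp22_integrable (f g : pt R -> R) :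
  inLp Omega 2 f -> inLp Omega 2 g ->
  vol.-integrable Omega (EFin \o (fun x => f x * g x)).
Proof.
move=> f2 g2; apply/inLp1_integrable; apply: (@inLp_mul _ _ mO 2 2 1) => //.
by rewrite invr1; lra.
Qed.

(** The iterated partial derivatives quantified over in the definition of
    smoothness. *)
Definition iter_derive (s : seq 'I_3) (phi : pt R -> R) : pt R -> R :=
  foldr (fun i f => 'D_(unit_vec i) f) phi s.

Lemma iter_deriveB (s : seq 'I_3) (phi psi : pt R -> R) :
  smooth phi -> smooth psi ->
  iter_derive s (phi \- psi) = iter_derive s phi \- iter_derive s psi.
Proof.
move=> sphi spsi; elim: s => //= i s ->; apply/funext => x /=.
rewrite deriveB//; first exact: (sphi s).2.
exact: (spsi s).2.
Qed.

Lemma smoothB (phi psi : pt R -> R) :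
  smooth phi -> smooth psi -> smooth (phi \- psi).
Proof.
move=> sphi spsi s; have [cphi dphi] := sphi s; have [cpsi dpsi] := spsi s.
rewrite /= [foldr _ _ _](iter_deriveB s sphi spsi); split.
  by move=> x; apply: continuousB; [exact: cphi|exact: cpsi].
by move=> i x; apply: derivableB; [exact: dphi|exact: dpsi].
Qed.

Lemma test_functionB (phi psi : pt R -> R) :
  test_function Omega phi -> test_function Omega psi ->
  test_function Omega (phi \- psi).
Proof.
move=> [sphi kphi Ophi] [spsi kpsi Opsi].
have sub : closure [set x | (phi \- psi) x != 0] `<=`
    closure [set x | phi x != 0] `|` closure [set x | psi x != 0].
  rewrite -closureU; apply: closure_subset => x /=.
  apply: contraPP => /not_orP[] /negP/negPn/eqP -> /negP/negPn/eqP ->.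
  by rewrite subrr eqxx.
split; first exact: smoothB.
- apply: subclosed_compact sub; first exact: closed_closure.
  exact: compactU.
- by move=> x /sub[/Ophi|/Opsi].
Qed.

Lemma test_function_inLp (phi : pt R -> R) :
  test_function Omega phi -> inLp Omega 2 phi.
Proof.
move=> [sphi _ _]; apply: inLp_continuous => //.
by apply: continuous_subspaceT => x; exact: (sphi [::]).1.
Qed.

Lemma test_derive_inLp (phi : pt R -> R) (i : 'I_3) :
  test_function Omega phi -> inLp Omega 2 ('D_(unit_vec i) phi).
Proof.
move=> [sphi _ _]; apply: inLp_continuous => //.
by apply: continuous_subspaceT => x; exact: (sphi [:: i]).1.
Qed.

(** Test functions and their derivatives are continuous, hence bounded on
    Omega, so that both sides of the identity defining the weak gradient
    converge and are additive. *)
Lemma W1pB (v w : sob R) :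
  W1p Omega 2 v -> W1p Omega 2 w -> W1p Omega 2 (sobB v w).
Proof.
move=> [v2 gv2 wv] [w2 gw2 ww]; split.
- by apply: inLpB => //; lra.
- by move=> i; apply: inLpB => //; lra.
move=> phi tphi i.
have tp := test_function_inLp tphi; have td := test_derive_inLp i tphi.
under eq_Rintegral do rewrite mulrBl.
rewrite RintegralB//; [|exact: inLp22_integrable..].
rewrite wv// ww//; under [in RHS]eq_Rintegral do rewrite mulrBl.
rewrite RintegralB//; [|exact: inLp22_integrable..].
by rewrite opprB addrC opprK.
Qed.

Lemma cvg_eLpB (f g : nat -> pt R -> R) (a b : pt R -> R) :
  (forall n, inLp Omega 2 (f n)) -> (forall n, inLp Omega 2 (g n)) ->
  inLp Omega 2 a -> inLp Omega 2 b ->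
  (fun n => eLp Omega 2 (fun x => f n x - a x)) @ \oo --> 0%E ->
  (fun n => eLp Omega 2 (fun x => g n x - b x)) @ \oo --> 0%E ->
  (fun n => eLp Omega 2 (fun x => (f n x - g n x) - (a x - b x))) @ \oo --> 0%E.
Proof.
move=> f2 g2 a2 b2 fa gb.
have fagb : (fun n => eLp Omega 2 (fun x => f n x - a x)%R
    + eLp Omega 2 (fun x => g n x - b x)%R)%E @ \oo --> 0%E.
  by rewrite -[X in _ --> X]adde0; apply: cvgeD.
apply: squeeze_cvge (cvg_cst _) fagb.
apply: nearW => n; rewrite eLp_ge0 /=.
have -> : (fun x => (f n x - g n x) - (a x - b x))%R
    = (fun x => (f n x - a x) - (g n x - b x))%R.
  by apply/funext => x; ring.
apply: eLpB => //; first lra.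
- by apply: measurable_funB; [case: (f2 n)|case: a2].
- by apply: measurable_funB; [case: (g2 n)|case: b2].
Qed.

Lemma H01B (v w : sob R) : H01 Omega v -> H01 Omega w -> H01 Omega (sobB v w).
Proof.
move=> [Wv [phi [tphi cphi dphi]]] [Ww [psi [tpsi cpsi dpsi]]].
split; first exact: W1pB.
have [v2 gv2 _] := Wv; have [w2 gw2 _] := Ww.
exists (fun n => phi n \- psi n); split.
- by move=> n; exact: test_functionB.
- by apply: cvg_eLpB => // n; exact: test_function_inLp.
move=> i /=.
have -> : (fun n => eLp Omega 2 (fun x => 'D_(unit_vec i) (phi n \- psi n) x
      - (sgrad v i x - sgrad w i x)))
  = (fun n => eLp Omega 2 (fun x => ('D_(unit_vec i) (phi n) x
      - 'D_(unit_vec i) (psi n) x) - (sgrad v i x - sgrad w i x))).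
  apply/funext => n; congr eLp; apply/funext => x; congr (_ - _).
  have [sphi _ _] := tphi n; have [spsi _ _] := tpsi n.
  exact: (congr1 (@^~ x) (iter_deriveB [:: i] sphi spsi)).
by apply: cvg_eLpB => // n; exact: test_derive_inLp.
Qed.

Lemma is_polyB (k : nat) (p q : pt R -> R) :
  is_poly k p -> is_poly k q -> is_poly k (p \- q).
Proof.
move=> [c pE] [d qE]; exists (fun i j l => c i j l - d i j l) => x /=.
rewrite pE qE -sumrB; apply: eq_bigr => i _.
rewrite -sumrB; apply: eq_bigr => j _.
by rewrite -sumrB; apply: eq_bigr => l _; rewrite mulrBl.
Qed.

Lemma poly_onB (k : nat) K (f g : pt R -> R) :
  poly_on k K f -> poly_on k K g -> poly_on k K (fun x => f x - g x).
Proof.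
move=> [p pp fp] [q pq gq]; exists (p \- q); first exact: is_polyB.
by move=> x Kx /=; rewrite fp// gq.
Qed.

Lemma velocity_localB (fe : fe_pair R) K (f g : pt R -> R) :
  velocity_local fe K f -> velocity_local fe K g ->
  velocity_local fe K (fun x => f x - g x).
Proof.
case: fe => [|b]; first exact: poly_onB.
move=> [p [c [pp fE]]] [q [d [pq gE]]]; exists (p \- q), (c - d).
by split; [exact: is_polyB|move=> x Kx /=; rewrite fE// gE//; ring].
Qed.

Lemma within_continuousB (A : set (pt R)) (f g : pt R -> R) :
  {within A, continuous f} -> {within A, continuous g} ->
  {within A, continuous (fun x => f x - g x)}.
Proof. by move=> cf cg x; apply: continuousB; [exact: cf|exact: cg]. Qed.

Lemma XhB fe T (u w : 'I_3 -> sob R) :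
  Xh Omega fe T u -> Xh Omega fe T w -> Xh Omega fe T (vecB u w).
Proof.
move=> Xu Xw i; have [cu lu hu] := Xu i; have [cw lw hw] := Xw i; split.
- exact: within_continuousB.
- by move=> K TK; apply: velocity_localB; [exact: lu|exact: lw].
- exact: H01B.
Qed.

Lemma YhB fe T (S S' : sob R) :
  Yh Omega fe T S -> Yh Omega fe T S' -> Yh Omega fe T (sobB S S').
Proof.
move=> [cS lS hS] [cS' lS' hS']; split.
- exact: within_continuousB.
- by move=> K TK; apply: poly_onB; [exact: lS|exact: lS'].
- exact: H01B.
Qed.

Lemma MhB T (q q' : pt R -> R) :
  Mh Omega T q -> Mh Omega T q' -> Mh Omega T (fun x => q x - q' x).
Proof.
move=> [q2 q0 cq lq] [q2' q0' cq' lq']; split.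
- by apply: inLpB => //; lra.
- rewrite RintegralB ?q0 ?q0' ?subrr//.
  + exact/inLp1_integrable/inLp2_inLp1.
  + exact/inLp1_integrable/inLp2_inLp1.
- exact: within_continuousB.
- by move=> K TK; apply: poly_onB; [exact: lq|exact: lq'].
Qed.

End Differences.

(** * Integrability of products of bounded and square-integrable functions *)

Section Integrability.
Context {R : realType} (Omega : set (pt R)).
Hypothesis oO : open Omega.
Hypothesis bO : bounded_set Omega.

Let mO : measurable Omega. Proof. exact: open_measurable_pt. Qed.

Definition bounded_measurable (f : pt R -> R) : Prop :=
  measurable_fun Omega f /\ exists M : R, forall x, Omega x -> `|f x| <= M.

(** What a discrete function contributes to integrability: it is bounded
    itself, and its weak gradient is square integrable. *)
Definition bounded_H1 (v : sob R) : Prop :=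
  bounded_measurable v /\ forall i, inLp Omega 2 (sgrad v i).

Lemma bounded_inLp (p : R) (f : pt R -> R) : 0 < p ->
  bounded_measurable f -> inLp Omega p f.
Proof. by move=> p0 [mf [M fM]]; exact: inLp_bounded fM. Qed.

Lemma bounded_measurableM (f g : pt R -> R) : bounded_measurable f ->
  bounded_measurable g -> bounded_measurable (fun x => f x * g x).
Proof.
move=> [mf [M fM]] [mg [N gN]]; split; first exact: measurable_funM.
by exists (M * N) => x Ox; rewrite normrM ler_pM ?fM ?gN.
Qed.

Lemma bounded_measurableB (f g : pt R -> R) : bounded_measurable f ->
  bounded_measurable g -> bounded_measurable (fun x => f x - g x).
Proof.
move=> [mf [M fM]] [mg [N gN]]; split; first exact: measurable_funB.
by exists (M + N) => x Ox; rewrite (le_trans (ler_normB _ _))// lerD ?fM ?gN.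
Qed.

Lemma bounded_measurable_sum (I : Type) (s : seq I) (F : I -> pt R -> R) :
  (forall i, bounded_measurable (F i)) ->
  bounded_measurable (fun x => \sum_(i <- s) F i x).
Proof.
move=> bF; elim: s => [|i s [mS [M SM]]].
  split; first by apply: measurable_sum => i; case: (bF i).
  by exists 0 => x _; rewrite big_nil normr0.
split; first by apply: measurable_sum => j; case: (bF j).
have [_ [N FN]] := bF i; exists (N + M) => x Ox.
by rewrite big_cons (le_trans (ler_normD _ _))// lerD ?FN ?SM.
Qed.

Lemma lipschitz_dist (k : R -> R) (L x y : R) :
  L.-lipschitz k -> `|k x - k y| <= L * `|x - y|.
Proof. by move=> /(_ (x, y) (conj I I)). Qed.

Lemma lipschitz_ge0 (k : R -> R) (L : R) : L.-lipschitz k -> 0 <= L.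
Proof.
move=> /(lipschitz_dist 0 1); rewrite sub0r normrN normr1 mulr1.
exact: le_trans.
Qed.

Lemma bounded_measurable_comp (k : R -> R) (L M : R) (f : pt R -> R) :
  L.-lipschitz k -> (forall r, `|k r| <= M) -> measurable_fun Omega f ->
  bounded_measurable (fun x => k (f x)).
Proof.
move=> kL kM mf; split; last by exists M.
apply: (measurableT_comp _ mf); apply: continuous_measurable_fun => x.
have L0 := lipschitz_ge0 kL.
apply/cvgrPdist_le => e e0; near=> y.
apply: le_trans (lipschitz_dist x y kL) _.
have : `|x - y| <= e / (L + 1).
  by near: y; apply: cvgr_dist_le; [exact: cvg_id|rewrite divr_gt0// ltr_pwDr].
move=> /(ler_wpM2l L0)/le_trans; apply.
by rewrite mulrA ler_pdivrMr ?ltr_pwDr// mulrDr mulr1 mulrC lerDl ltW.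
Unshelve. all: by end_near. Qed.

Lemma bounded_mul_inLp (p : R) (b f : pt R -> R) : 0 < p ->
  bounded_measurable b -> inLp Omega p f -> inLp Omega p (fun x => b x * f x).
Proof.
move=> p0 [mb [M bM]] fL; have [mf _] := fL.
apply: (@inLp_dom _ _ mO M) fL => //; first exact: measurable_funM.
by move=> x Ox; rewrite normrM ler_wpM2r// bM.
Qed.

Lemma inLp1M (f g : pt R -> R) :
  inLp Omega 2 f -> inLp Omega 2 g -> inLp Omega 1 (fun x => f x * g x).
Proof.
by move=> f2 g2; apply: (@inLp_mul _ _ mO 2 2 1) => //; rewrite invr1; lra.
Qed.

Lemma inLp1_sumM (I : finType) (a b : I -> pt R -> R) :
  (forall i, inLp Omega 2 (a i)) -> (forall i, inLp Omega 2 (b i)) ->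
  inLp Omega 1 (fun x => \sum_i a i x * b i x).
Proof. by move=> a2 b2; apply: inLp_sum => // i; exact: inLp1M. Qed.

Lemma measurable_sqrt (f : pt R -> R) :
  measurable_fun Omega f -> measurable_fun Omega (fun x => Num.sqrt (f x)).
Proof.
move=> mf; apply: (measurableT_comp _ mf).
by apply: continuous_measurable_fun; exact: sqrt_continuous.
Qed.

(** An arbitrary finite index type treats the gradient of a scalar, indexed by
    coordinates, and the gradient of a vector field, indexed by pairs of
    coordinates, alike. *)
Definition euclidean_length (I : finType) (a : I -> pt R -> R) (x : pt R) : R :=
  Num.sqrt (\sum_i a i x * a i x).

Lemma length_ge0 (I : finType) (a : I -> pt R -> R) x : 0 <= euclidean_length a x.
Proof. exact: sqrtr_ge0. Qed.

Lemma length_sqr (I : finType) (a : I -> pt R -> R) x :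
  euclidean_length a x * euclidean_length a x = \sum_i a i x * a i x.
Proof.
rewrite -expr2 sqr_sqrtr//.
by apply: sumr_ge0 => i _; rewrite -expr2 sqr_ge0.
Qed.

Lemma length_le_sum (I : finType) (a : I -> pt R -> R) x :
  euclidean_length a x <= \sum_i `|a i x|.
Proof.
have S0 : 0 <= \sum_i `|a i x| by apply: sumr_ge0.
rewrite -(@ler_sqr _ (euclidean_length a x)) ?nnegrE ?length_ge0//.
rewrite expr2 length_sqr expr2 mulr_suml ler_sum// => i _.
rewrite -expr2 -real_normK ?num_real//.
rewrite expr2 ler_wpM2l// (bigD1 i)//= lerDl.
by apply: sumr_ge0.
Qed.

Lemma measurable_length (I : finType) (a : I -> pt R -> R) :
  (forall i, measurable_fun Omega (a i)) -> measurable_fun Omega (euclidean_length a).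
Proof.
move=> ma; apply: measurable_sqrt; apply: measurable_sum => i.
exact: measurable_funM.
Qed.

Lemma inLp_length (I : finType) (p : R) (a : I -> pt R -> R) : 1 <= p ->
  (forall i, inLp Omega p (a i)) -> inLp Omega p (euclidean_length a).
Proof.
move=> p1 aL; have p0 : 0 < p by exact: lt_le_trans p1.
have sL : inLp Omega p (fun x => \sum_i `|a i x|).
  apply: inLp_sum => // i; have [ma _] := aL i.
  apply: (@inLp_dom _ _ mO 1) (aL i) => //; first exact: measurableT_comp.
  by move=> x _; rewrite normr_id mul1r.
apply: (@inLp_dom _ _ mO 1) sL => //.
  by apply: measurable_length => i; case: (aL i).
move=> x _; rewrite mul1r !ger0_norm ?length_ge0 ?sumr_ge0//.
exact: length_le_sum.
Qed.

Lemma Lp_norm2_length (I : finType) (a : I -> pt R -> R) :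
  (forall i, inLp Omega 2 (a i)) ->
  Lp_norm Omega 2 (euclidean_length a) ^+ 2
    = \int[vol]_(x in Omega) \sum_i a i x * a i x.
Proof.
move=> a2; rewrite Lp_norm2_sqr//; last by apply: inLp_length => //; lra.
by apply: eq_Rintegral => x _; rewrite length_sqr.
Qed.

Lemma bounded_length (I : finType) (a : I -> pt R -> R) :
  (forall i, bounded_measurable (a i)) -> bounded_measurable (euclidean_length a).
Proof.
move=> ba; split; first by apply: measurable_length => i; case: (ba i).
have abs_bounded i : bounded_measurable (fun x => `|a i x|).
  have [ma [M aM]] := ba i; split; first exact: measurableT_comp.
  by exists M => x Ox; rewrite normr_id aM.
have [_ [M sM]] := bounded_measurable_sum (index_enum I) abs_bounded.
exists M => x /sM; apply: le_trans.
by rewrite !ger0_norm ?length_ge0 ?sumr_ge0 ?length_le_sum.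
Qed.

End Integrability.

(** * Diffusion terms with a Lipschitz coefficient *)

Section Estimates.
Context {R : realType} (Omega : set (pt R)).
Hypothesis oO : open Omega.
Hypothesis bO : bounded_set Omega.

Let mO : measurable Omega. Proof. exact: open_measurable_pt. Qed.

Lemma Lp_norm_normr (p : R) (f : pt R -> R) : 0 < p ->
  Lp_norm Omega p (fun x => `|f x|) = Lp_norm Omega p f.
Proof.
move=> p0; congr fine.
apply: (@poweR_inj _ _ _ p); rewrite ?gt_eqF ?eLp_ge0//.
rewrite !(eLp_poweR _ _ p0); apply: eq_integral => x _.
by rewrite normr_id.
Qed.

Lemma inLp_normr (p : R) (f : pt R -> R) : 0 < p ->
  inLp Omega p f -> inLp Omega p (fun x => `|f x|).
Proof.
move=> p0 fL; have [mf _] := fL.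
apply: (@inLp_dom _ _ mO 1) fL => //; first exact: measurableT_comp.
by move=> x _; rewrite normr_id mul1r.
Qed.

(** In the estimates below F is an inner product, and Cauchy--Schwarz gives
    the pointwise bound by the product of three lengths. *)
Lemma Rintegral_hoelder3_dom (p q L : R) (F f g h : pt R -> R) :
  0 < p -> 0 < q -> p^-1 + q^-1 = 2^-1 -> 0 <= L ->
  inLp Omega p f -> inLp Omega q g -> inLp Omega 2 h -> inLp Omega 1 F ->
  (forall x, Omega x -> `|F x| <= L * (`|f x| * g x * h x)) ->
  `|\int[vol]_(x in Omega) F x|
    <= L * (Lp_norm Omega p f * Lp_norm Omega q g * Lp_norm Omega 2 h).
Proof.
move=> p0 q0 pq L0 fL gL hL FL Ffgh.
rewrite -(Lp_norm_normr _ p0).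
have [iL] := Rintegral_hoelder3 mO p0 q0 pq (inLp_normr p0 fL) gL hL.
move=> /(ler_wpM2l L0); apply: le_trans.
have iF : vol.-integrable Omega (EFin \o F) by exact/inLp1_integrable.
apply: le_trans (le_normr_Rintegral mO iF) _.
apply: le_trans (ler_wpM2l L0 (ler_norm _)).
have i1 := (inLp1_integrable _ _).1 iL.
rewrite -RintegralZl//; apply: le_Rintegral => //.
- by apply/inLp1_integrable => //; exact: inLp_normr.
- apply/inLp1_integrable => //; apply: (bounded_mul_inLp oO) => //.
  by split; [exact: measurable_cst|exists `|L|].
Qed.

Lemma Rintegral_sum (I : Type) (s : seq I) (F : I -> pt R -> R) :
  (forall i, inLp Omega 1 (F i)) ->
  \int[vol]_(x in Omega) \sum_(i <- s) F i x
    = \sum_(i <- s) \int[vol]_(x in Omega) F i x.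
Proof.
move=> F1; elim: s => [|i s IH].
  rewrite big_nil; under eq_Rintegral do rewrite big_nil.
  by rewrite Rintegral_cst// mul0r.
rewrite big_cons -IH; under eq_Rintegral do rewrite big_cons.
by rewrite RintegralD//; apply/inLp1_integrable => //; exact: inLp_sum.
Qed.

Section Diffusion.
Context (k : R -> R) (kmin kmax L : R).
Hypothesis kmin0 : 0 < kmin.
Hypothesis k_bounds : forall r, kmin <= k r <= kmax.
Hypothesis k_lipschitz : L.-lipschitz k.

Lemma coefficient_bounded (T : pt R -> R) : measurable_fun Omega T ->
  bounded_measurable Omega (fun x => k (T x)).
Proof.
apply: (bounded_measurable_comp (M := kmax) k_lipschitz) => r.
have /andP[kr rk] := k_bounds r.
by rewrite ger0_norm// (le_trans (ltW kmin0)).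
Qed.

Lemma diffusion_inLp1 (I : finType) (T : pt R -> R) (a b : I -> pt R -> R) :
  measurable_fun Omega T ->
  (forall i, inLp Omega 2 (a i)) -> (forall i, inLp Omega 2 (b i)) ->
  inLp Omega 1 (fun x => k (T x) * \sum_i a i x * b i x).
Proof.
move=> mT a2 b2; apply: (bounded_mul_inLp oO) => //.
  exact: coefficient_bounded.
exact: inLp1_sumM.
Qed.

Lemma diffusion_coercive (I : finType) (T : pt R -> R) (a : I -> pt R -> R) :
  measurable_fun Omega T -> (forall i, inLp Omega 2 (a i)) ->
  kmin * Lp_norm Omega 2 (euclidean_length a) ^+ 2
    <= \int[vol]_(x in Omega) (k (T x) * \sum_i a i x * a i x).
Proof.
move=> mT a2; have iaa := inLp1_sumM oO a2 a2.
rewrite (Lp_norm2_length oO a2) -RintegralZl//; last exact/inLp1_integrable.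
apply: le_Rintegral => //.
- by apply/inLp1_integrable; apply: (bounded_mul_inLp oO) => //;
    split; [exact: measurable_cst|exists `|kmin|].
- by apply/inLp1_integrable; exact: diffusion_inLp1.
- move=> x _; rewrite ler_wpM2r//; last by case/andP: (k_bounds (T x)).
  by rewrite -length_sqr mulr_ge0 ?length_ge0.
Qed.

(** Write k(T1) a - k(T2) b = k(T2) (a - b) + (k(T1) - k(T2)) a. The first part
    is coercive. In the second the Lipschitz bound turns the difference of
    coefficients into |T1 - T2|, which is taken in L^6 against a in L^3. *)
Lemma diffusion_difference (I : finType) (T1 T2 : pt R -> R)
    (a b : I -> pt R -> R) :
  measurable_fun Omega T1 -> measurable_fun Omega T2 ->
  (forall i, inLp Omega 2 (a i)) -> (forall i, inLp Omega 2 (b i)) ->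
  (forall i, inLp Omega 3 (a i)) -> inLp Omega 6 (fun x => T1 x - T2 x) ->
  let e i x := a i x - b i x in
  kmin * Lp_norm Omega 2 (euclidean_length e) ^+ 2
    - L * (Lp_norm Omega 6 (fun x => T1 x - T2 x) * Lp_norm Omega 3 (euclidean_length a)
           * Lp_norm Omega 2 (euclidean_length e))
  <= \int[vol]_(x in Omega) (k (T1 x) * \sum_i a i x * e i x)
     - \int[vol]_(x in Omega) (k (T2 x) * \sum_i b i x * e i x).
Proof.
move=> mT1 mT2 a2 b2 a3 T6; cbv zeta; set e := fun i x => _.
have e2 i : inLp Omega 2 (e i) by apply: inLpB => //; lra.
have L0 := lipschitz_ge0 k_lipschitz.
have iae : inLp Omega 1 (fun x => \sum_i a i x * e i x) by exact: inLp1_sumM.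
have la3 : inLp Omega 3 (euclidean_length a) by apply: inLp_length => //; lra.
have le2 : inLp Omega 2 (euclidean_length e) by apply: inLp_length => //; lra.
have bk1 := coefficient_bounded mT1; have bk2 := coefficient_bounded mT2.
pose F x := (k (T1 x) - k (T2 x)) * \sum_i a i x * e i x.
have F1 : inLp Omega 1 F.
  by apply: (bounded_mul_inLp oO) => //; exact: bounded_measurableB.
rewrite -RintegralB//; [|exact/inLp1_integrable/diffusion_inLp1..].
have -> : \int[vol]_(x in Omega) (k (T1 x) * (\sum_i a i x * e i x)
      - k (T2 x) * (\sum_i b i x * e i x))
    = \int[vol]_(x in Omega) (k (T2 x) * (\sum_i e i x * e i x) + F x).
  apply: eq_Rintegral => x _; rewrite /F.
  have -> : \sum_i e i x * e i x
      = \sum_i a i x * e i x - \sum_i b i x * e i x.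
    by rewrite -sumrB; apply: eq_bigr => i _; rewrite /e; ring.
  by ring.
rewrite RintegralD//; [|exact/inLp1_integrable/diffusion_inLp1
                       |exact/inLp1_integrable].
apply: lerD; first exact: diffusion_coercive.
rewrite lerNl; apply: le_trans (ler_norm _) _.
rewrite normrN; apply: Rintegral_hoelder3_dom => //; first lra.
move=> x _; rewrite /F normrM.
apply: le_trans (ler_pM _ _ (lipschitz_dist (T1 x) (T2 x) k_lipschitz)
  (sum_cauchy_schwarz (fun i => a i x) (fun i => e i x))) _ => //=.
by rewrite !mulrA.
Qed.
End Diffusion.
End Estimates.

(** * Convection, power and mass terms *)

Section Convection.
Context {R : realType} (Omega : set (pt R)).
Hypothesis oO : open Omega.
Hypothesis bO : bounded_set Omega.

Let mO : measurable Omega. Proof. exact: open_measurable_pt. Qed.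

Implicit Types (u v w : 'I_3 -> sob R) (S T : sob R).

Lemma bounded_H1B S T : bounded_H1 Omega S -> bounded_H1 Omega T ->
  bounded_H1 Omega (sobB S T).
Proof.
move=> [bS gS] [bT gT]; split; first exact: bounded_measurableB.
by move=> i; apply: inLpB => //; lra.
Qed.

Lemma Xh_bounded_H1 fe Th u : Xh Omega fe Th u ->
  forall i, bounded_H1 Omega (u i).
Proof.
move=> Xu i; have [cu _ [[_ gu _] _]] := Xu i; split=> //; split.
  exact: continuous_measurable_pt.
exact: continuous_bounded_pt.
Qed.

Lemma Yh_bounded_H1 fe Th T : Yh Omega fe Th T -> bounded_H1 Omega T.
Proof.
move=> [cT _ [[_ gT _] _]]; split=> //; split.
  exact: continuous_measurable_pt.
exact: continuous_bounded_pt.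
Qed.

Lemma scalar_convection_inLp2 u T S :
  (forall i, bounded_measurable Omega (u i)) ->
  (forall i, inLp Omega 2 (sgrad T i)) -> bounded_measurable Omega S ->
  inLp Omega 2 (fun x => dot3 (at_pt u x) (grad T x) * S x).
Proof.
move=> bu gT bS.
have -> : (fun x => dot3 (at_pt u x) (grad T x) * S x)
    = (fun x => S x * dot3 (at_pt u x) (grad T x)).
  by apply/funext => x; rewrite mulrC.
apply: (bounded_mul_inLp oO) => //; rewrite /dot3.
apply: inLp_sum => //; first lra.
by move=> i; exact: (bounded_mul_inLp oO _ (bu i) (gT i)).
Qed.

Lemma aST_integrable u T S : (forall i, bounded_H1 Omega (u i)) ->
  bounded_H1 Omega T -> bounded_H1 Omega S ->
  vol.-integrable Omega (EFin \o (fun x =>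
    dot3 (at_pt u x) (grad T x) * S x - dot3 (at_pt u x) (grad S x) * T x)).
Proof.
move=> bu [bT gT] [bS gS]; apply/inLp1_integrable/inLp2_inLp1 => //.
have b i : bounded_measurable Omega (u i) by case: (bu i).
by apply: inLpB => //; [lra|exact: scalar_convection_inLp2|
  exact: scalar_convection_inLp2].
Qed.

Lemma aST_diag u T : aST Omega u T T = 0.
Proof.
rewrite /aST; under eq_Rintegral do rewrite subrr.
by rewrite Rintegral_cst// mul0r mulr0.
Qed.

(** The transport by u2 drops out of the difference because it is
    skew-symmetric, which leaves the transport of T1 by u1 - u2. *)
Lemma aST_difference u1 u2 T1 T2 :
  (forall i, bounded_H1 Omega (u1 i)) -> (forall i, bounded_H1 Omega (u2 i)) ->
  bounded_H1 Omega T1 -> bounded_H1 Omega T2 ->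
  let e := sobB T1 T2 in
  aST Omega u1 T1 e - aST Omega u2 T2 e = aST Omega (vecB u1 u2) T1 e.
Proof.
move=> bu1 bu2 bT1 bT2; cbv zeta; set e := sobB T1 T2.
have be : bounded_H1 Omega e by exact: bounded_H1B.
rewrite /aST -mulrBr; congr (_ * _).
rewrite -RintegralB//; [|exact: aST_integrable..].
apply: eq_Rintegral => x _.
have eE : e x = T1 x - T2 x by [].
have gE a : dot3 a (grad e x) = dot3 a (grad T1 x) - dot3 a (grad T2 x).
  exact: dot3Br.
have uE b : dot3 (at_pt (vecB u1 u2) x) b
    = dot3 (at_pt u1 x) b - dot3 (at_pt u2 x) b.
  exact: dot3Bl.
by rewrite !uE !gE eE; ring.
Qed.

(** Each of the two halves is estimated with exponents 4, 4 and 2. *)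
Lemma aST_bound u T S : (forall i, bounded_H1 Omega (u i)) ->
  bounded_H1 Omega T -> bounded_H1 Omega S ->
  let U4 := Lp_norm Omega 4 (fun x => enorm (at_pt u x)) in
  `|aST Omega u T S| <=
    2^-1 * (U4 * Lp_norm Omega 4 S * grad_norm Omega 2 T
            + U4 * Lp_norm Omega 4 T * grad_norm Omega 2 S).
Proof.
move=> bu bT bS; cbv zeta.
have b i : bounded_measurable Omega (u i) by case: (bu i).
have bU : bounded_measurable Omega (fun x => enorm (at_pt u x)).
  exact: (bounded_length b).
have half S' T' : bounded_H1 Omega S' -> bounded_H1 Omega T' ->
    inLp Omega 1 (fun x => dot3 (at_pt u x) (grad T' x) * S' x) /\
    `|\int[vol]_(x in Omega) (dot3 (at_pt u x) (grad T' x) * S' x)|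
      <= Lp_norm Omega 4 (fun x => enorm (at_pt u x)) * Lp_norm Omega 4 S'
         * grad_norm Omega 2 T'.
  move=> [bS' gS'] [bT' gT'].
  have i1 : inLp Omega 1 (fun x => dot3 (at_pt u x) (grad T' x) * S' x).
    by apply: inLp2_inLp1 => //; exact: scalar_convection_inLp2.
  split; first exact: i1.
  have p4 : 0 < 4 :> R by [].
  have e4 : 4^-1 + 4^-1 = 2^-1 :> R by lra.
  have UL : inLp Omega 4 (fun x => enorm (at_pt u x)) by exact: bounded_inLp.
  have SL : inLp Omega 4 (fun x => `|S' x|).
    by apply: inLp_normr => //; exact: bounded_inLp.
  have GL : inLp Omega 2 (euclidean_length (sgrad T')).
    by apply: inLp_length => //; lra.
  have := Rintegral_hoelder3_dom oO p4 p4 e4 ler01 UL SL GL i1.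
  rewrite mul1r (Lp_norm_normr Omega S' p4); apply => x _.
  rewrite mul1r normrM mulrAC ler_wpM2r//.
  by rewrite (ger0_norm (enorm_ge0 _)); exact: dot3_cauchy_schwarz.
have [i1 h1] := half S T bS bT; have [i2 h2] := half T S bT bS.
rewrite /aST normrM ger0_norm ?invr_ge0// ler_wpM2l ?invr_ge0//.
rewrite RintegralB//; [|exact/inLp1_integrable..].
by apply: le_trans (ler_normB _ _) _; exact: lerD.
Qed.

Lemma aN_inLp1 u v w : (forall i, bounded_H1 Omega (u i)) ->
  (forall i, bounded_H1 Omega (v i)) -> (forall i, bounded_H1 Omega (w i)) ->
  inLp Omega 1
    (fun x => \sum_(i < 3) dot3 (at_pt u x) (grad (v i) x) * w i x).
Proof.
move=> bu bv bw; apply: inLp2_inLp1 => //; apply: inLp_sum => //; first lra.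
move=> i; apply: scalar_convection_inLp2.
- by move=> j; case: (bu j).
- by case: (bv i).
- by case: (bw i).
Qed.

Lemma aSN_diag u v : aSN Omega u v v = 0.
Proof. by rewrite /aSN subrr mulr0. Qed.

(** As for the temperature, only the transport of u1 by u1 - u2 survives. *)
Lemma aSN_difference u1 u2 :
  (forall i, bounded_H1 Omega (u1 i)) -> (forall i, bounded_H1 Omega (u2 i)) ->
  let e := vecB u1 u2 in
  aSN Omega u1 u1 e - aSN Omega u2 u2 e = aSN Omega e u1 e.
Proof.
move=> b1 b2; cbv zeta; set e := vecB u1 u2.
have be i : bounded_H1 Omega (e i) by exact: bounded_H1B.
have gE i a x : dot3 a (grad (e i) x)
    = dot3 a (grad (u1 i) x) - dot3 a (grad (u2 i) x).
  exact: dot3Br.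
have uE a x : dot3 (at_pt e x) a = dot3 (at_pt u1 x) a - dot3 (at_pt u2 x) a.
  exact: dot3Bl.
have eE i x : e i x = u1 i x - u2 i x by [].
have n1 : aN Omega u1 u1 e - aN Omega u2 u2 e = aN Omega e u1 e + aN Omega u2 e e.
  rewrite /aN -RintegralB//; [|exact/inLp1_integrable/aN_inLp1..].
  rewrite -RintegralD//; [|exact/inLp1_integrable/aN_inLp1..].
  apply: eq_Rintegral => x _; rewrite -sumrB -big_split; apply: eq_bigr => i _.
  by rewrite /= uE gE; ring.
have n2 : aN Omega u1 e u1 - aN Omega u2 e u2 = aN Omega e e u1 + aN Omega u2 e e.
  rewrite /aN -RintegralB//; [|exact/inLp1_integrable/aN_inLp1..].
  rewrite -RintegralD//; [|exact/inLp1_integrable/aN_inLp1..].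
  apply: eq_Rintegral => x _; rewrite -sumrB -big_split; apply: eq_bigr => i _.
  by rewrite /= uE ?eE; ring.
by rewrite /aSN -mulrBr; congr (_ * _); lra.
Qed.

Lemma aSN_bound CN u v w : convection_constant Omega CN ->
  H01v Omega u -> H01v Omega v -> H01v Omega w ->
  `|aSN Omega u v w| <=
    CN * gradv_norm Omega 2 u * gradv_norm Omega 2 v * gradv_norm Omega 2 w.
Proof.
move=> [_ hC] hu hv hw; rewrite /aSN normrM ger0_norm ?invr_ge0//.
have h1 := hC _ _ _ hu hv hw; have h2 := hC _ _ _ hu hw hv.
rewrite mulrC ler_pdivrMr//; apply: le_trans (ler_normB _ _) _.
move: h1 h2; nra.
Qed.

Lemma forchheimer_inLp1 (m : R) u v : 0 <= m ->
  (forall i, bounded_H1 Omega (u i)) -> (forall i, bounded_H1 Omega (v i)) ->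
  inLp Omega 1 (fun x =>
    enorm (at_pt u x) `^ m * dot3 (at_pt u x) (at_pt v x)).
Proof.
move=> m0 bu bv.
have b i : bounded_measurable Omega (u i) by case: (bu i).
have b' i : bounded_measurable Omega (v i) by case: (bv i).
apply: bounded_inLp => //; apply: bounded_measurableM; last first.
  by apply: bounded_measurable_sum => i; exact: (bounded_measurableM (b i) (b' i)).
have [mU [M UM]] := bounded_length b; split.
  exact: (measurableT_comp (measurable_powR m) mU).
exists (M `^ m) => x Ox.
have xM : enorm (at_pt u x) <= M.
  by apply: le_trans (UM _ Ox); exact: ler_norm.
rewrite ger0_norm ?powR_ge0// ge0_ler_powR// nnegrE ?enorm_ge0//.
exact: le_trans (enorm_ge0 _) xM.
Qed.

Lemma mass_inLp1 u v :
  (forall i, bounded_H1 Omega (u i)) -> (forall i, bounded_H1 Omega (v i)) ->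
  inLp Omega 1 (fun x => dot3 (at_pt u x) (at_pt v x)).
Proof.
move=> bu bv; apply: bounded_inLp => //.
apply: bounded_measurable_sum => i.
by apply: bounded_measurableM; [case: (bu i)|case: (bv i)].
Qed.

Lemma div_inLp2 u : (forall i, bounded_H1 Omega (u i)) ->
  inLp Omega 2 (div u).
Proof.
move=> bu; apply: inLp_sum => //; first lra.
by move=> i; case: (bu i).
Qed.

Lemma gradv_normE (p : R) u : gradv_norm Omega p u
  = Lp_norm Omega p (euclidean_length (fun ij : 'I_3 * 'I_3 => sgrad (u ij.1) ij.2)).
Proof. by congr Lp_norm; apply/funext => x; rewrite ddotE. Qed.

End Convection.

(** * Dual norms and embedding constants *)

Section Constants.
Context {R : realType} (Omega : set (pt R)).
Hypothesis oO : open Omega.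
Hypothesis bO : bounded_set Omega.

Let mO : measurable Omega. Proof. exact: open_measurable_pt. Qed.

(** A negative best constant would make every gradient norm vanish, and then
    no constant would be best. *)
Lemma best_embedding_constant_ge0 (p C : R) :
  best_embedding_constant Omega p C -> 0 <= C.
Proof.
move=> [Cb Cmin]; rewrite leNgt; apply/negP => C0.
suff /Cmin : embedding_bound Omega p (C - 1) by rewrite lerBrDl gerDr ler10.
move=> v hv; have vC := Cb v hv.
have : 0 <= C * grad_norm Omega 2 v.
  by rewrite -lee_fin; apply: le_trans vC; exact: eLp_ge0.
rewrite nmulr_rge0// => gn0.
have g0 : grad_norm Omega 2 v = 0.
  by apply/eqP; rewrite eq_le gn0 Lp_norm_ge0.
by move: vC; rewrite g0 !mulr0.
Qed.

Lemma embedding_Lp_norm (p C : R) (v : sob R) :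
  embedding_bound Omega p C -> H01 Omega v ->
  inLp Omega p v /\ Lp_norm Omega p v <= C * grad_norm Omega 2 v.
Proof.
move=> /(_ v) + hv; move=> /(_ hv) vC.
have vL : inLp Omega p v.
  by have [[[mv _] _ _] _] := hv; split=> //; exact: le_lt_trans vC (ltry _).
by split => //; rewrite -lee_fin Lp_normE.
Qed.

(** The supremum ranges over the quotients with nonzero denominator only; at a
    vector of norm zero the functional vanishes because it is bounded. *)
Lemma dual_norm_bound (V : Type) (P : V -> Prop) (N phi : V -> R) (C : R) :
  (forall v, 0 <= N v) -> (forall v, P v -> `|phi v| <= C * N v) ->
  let D := sup [set `|phi v| / N v | v in [set v | P v /\ N v != 0]] in
  0 <= D /\ forall v, P v -> phi v <= D * N v.
Proof.
move=> N0 phiC; cbv zeta; set A := [set _ | _ in _].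
have pos v : N v != 0 -> 0 < N v by move=> v0; rewrite lt_def v0 N0.
have ubA : has_ubound A.
  by exists C => _ [v [Pv v0] <-]; rewrite ler_pdivrMr ?pos//; exact: phiC.
split.
  have [->|/set0P [a Aa]] := eqVneq A set0; first by rewrite sup0.
  apply: le_trans (ub_le_sup ubA Aa).
  by case: Aa => v [_ v0] <-; rewrite divr_ge0 ?(ltW (pos _ v0)).
move=> v Pv; apply: le_trans (ler_norm _) _.
have [v0|v0] := eqVneq (N v) 0.
  by rewrite v0 mulr0; apply: le_trans (phiC v Pv) _; rewrite v0 mulr0.
by rewrite -ler_pdivrMr ?pos//; apply: (ub_le_sup ubA); exists v.
Qed.

Lemma Hm1_bound (g : (pt R -> R) -> R) : Hm1 Omega g ->
  0 <= Hm1_norm Omega g /\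
  forall v : sob R, H01 Omega v -> g v <= Hm1_norm Omega g * grad_norm Omega 2 v.
Proof.
move=> [_ [C gC]]; apply: (dual_norm_bound (phi := fun v : sob R => g v) _ gC).
by move=> v; exact: Lp_norm_ge0.
Qed.

Lemma Hm1v_bound (f : ('I_3 -> pt R -> R) -> R) : Hm1v Omega f ->
  0 <= Hm1v_norm Omega f /\
  forall v : 'I_3 -> sob R, H01v Omega v ->
    f (fun i => v i) <= Hm1v_norm Omega f * gradv_norm Omega 2 v.
Proof.
move=> [_ [C fC]].
apply: (dual_norm_bound (phi := fun v : 'I_3 -> sob R => f (fun i => v i)) _ fC).
by move=> v; exact: Lp_norm_ge0.
Qed.

Lemma gradv_norm2_sqr (u : 'I_3 -> sob R) :
  (forall i, bounded_H1 Omega (u i)) ->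
  gradv_norm Omega 2 u ^+ 2 = \sum_i grad_norm Omega 2 (u i) ^+ 2.
Proof.
move=> bu; have gu i j : inLp Omega 2 (sgrad (u i) j) by case: (bu i).
rewrite gradv_normE (Lp_norm2_length oO)//.
under eq_Rintegral do rewrite -(pair_big xpredT xpredT
  (fun i j => sgrad (u i) j _ * sgrad (u i) j _)) /=.
rewrite (Rintegral_sum oO)//; last by move=> i; exact: inLp1_sumM.
by apply: eq_bigr => i _; rewrite -(Lp_norm2_length oO).
Qed.

Lemma Lp_norm_sum_le (I : Type) (s : seq I) (p : R) (F : I -> pt R -> R) :
  1 <= p -> (forall i, inLp Omega p (F i)) ->
  Lp_norm Omega p (fun x => \sum_(i <- s) F i x)
    <= \sum_(i <- s) Lp_norm Omega p (F i).
Proof.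
move=> p1 FL; elim: s => [|i s IH].
  under [X in Lp_norm _ _ X]eq_fun => x do rewrite big_nil.
  rewrite big_nil /Lp_norm (_ : eLp Omega p _ = 0%E)//.
  have -> : eLp Omega p (fun=> 0) = 'N[vol]_(p%:E)[cst 0%E]%E.
    by apply: eq_Lnorm => x /=; rewrite /patch; case: ifP.
  by apply: Lnorm0; rewrite eqe gt_eqF// (lt_le_trans ltr01).
under [X in Lp_norm _ _ X]eq_fun => x do rewrite big_cons.
rewrite big_cons; apply: le_trans (lerD (lexx _) IH).
have sL : inLp Omega p (fun x => \sum_(j <- s) F j x) by exact: inLp_sum.
rewrite -lee_fin EFinD !Lp_normE//; last exact: inLpD.
by apply: eLpD => //; [case: (FL i)|case: sL].
Qed.

(** The scalar constant serves for vectors, by the triangle inequality in L^2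
    applied to the squares of the components. *)
Lemma vector_embedding4 (C : R) (u : 'I_3 -> sob R) :
  embedding_bound Omega 4 C -> 0 <= C -> H01v Omega u ->
  (forall i, bounded_H1 Omega (u i)) ->
  Lp_norm Omega 4 (fun x => enorm (at_pt u x)) <= C * gradv_norm Omega 2 u.
Proof.
move=> Cb C0 hu bu.
have uL i : inLp Omega 4 (u i) by case: (embedding_Lp_norm Cb (hu i)).
have uE i : Lp_norm Omega 4 (u i) <= C * grad_norm Omega 2 (u i).
  by case: (embedding_Lp_norm Cb (hu i)).
have sq (h : pt R -> R) : Lp_norm Omega 2 (fun x => h x * h x)
    = Lp_norm Omega 4 h ^+ 2.
  have -> : (fun x => h x * h x) = (fun x => `|h x| `^ 2).
    by apply/funext => x; rewrite powR_mulrn// -expr2 real_normK ?num_real.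
  rewrite /Lp_norm eLp_norm_powR// fine_poweR powR_mulrn ?fine_ge0 ?eLp_ge0//.
  by rewrite -natrM.
rewrite -(@ler_sqr _ (Lp_norm _ _ _)) ?nnegrE ?mulr_ge0 ?Lp_norm_ge0//.
rewrite -sq exprMn gradv_norm2_sqr// mulr_sumr.
under [X in Lp_norm _ _ X]eq_fun => x do rewrite -expr2 enorm_sqr.
have uu2 i : inLp Omega 2 (fun x => u i x * u i x).
  by apply: (@inLp_mul _ _ mO 4 4 2) => //; lra.
apply: le_trans (Lp_norm_sum_le _ _ uu2) _; first lra.
apply: ler_sum => i _; rewrite sq -exprMn.
by rewrite ler_sqr ?nnegrE ?mulr_ge0 ?Lp_norm_ge0.
Qed.

End Constants.

(** * Energy bounds and stability of the discrete problem *)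

Section AlmostEverywhere.
Context {R : realType} (Omega : set (pt R)).
Hypothesis oO : open Omega.

Let mO : measurable Omega. Proof. exact: open_measurable_pt. Qed.

Lemma Lp_norm_eq0_ae (p : R) (f : pt R -> R) : 0 < p -> inLp Omega p f ->
  Lp_norm Omega p f = 0 -> {ae vol, forall x, Omega x -> f x = 0}.
Proof.
move=> p0 fL f0; have [mf _] := fL.
have N0 : eLp Omega p f = 0%E by rewrite -Lp_normE// f0.
have mr : measurable_fun setT (EFin \o (f \_ Omega)).
  by apply/measurable_EFinP; exact: (measurable_restrictT _ mO).1.
have := Lnorm_eq0_eq0 mr (_ : (0 < p%:E)%E) N0; rewrite lte_fin => /(_ p0).
apply: filterS => x /(_ I) /= [fx] Ox; move: fx.
by rewrite /patch mem_set.
Qed.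

Lemma length_eq0_ae (I : finType) (p : R) (a : I -> pt R -> R) : 1 <= p ->
  (forall i, inLp Omega p (a i)) -> Lp_norm Omega p (euclidean_length a) = 0 ->
  {ae vol, forall x, Omega x -> forall i, a i x = 0}.
Proof.
move=> p1 aL /Lp_norm_eq0_ae; have p0 : 0 < p by exact: lt_le_trans p1.
move=> /(_ p0 (inLp_length oO p1 aL)).
apply: filterS => x lx Ox i; have := length_sqr a x.
rewrite lx// mul0r => /esym s0.
apply/eqP; rewrite -sqrf_eq0 expr2; apply/eqP.
by apply: (psumr_eq0P _ s0) => // j _; rewrite -expr2 sqr_ge0.
Qed.

Lemma Rintegral_ae_eq (f g : pt R -> R) :
  measurable_fun Omega f -> measurable_fun Omega g ->
  {ae vol, forall x, Omega x -> f x = g x} ->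
  \int[vol]_(x in Omega) f x = \int[vol]_(x in Omega) g x.
Proof.
move=> mf mg fg; congr fine; apply: ae_eq_integral => //.
- exact/measurable_EFinP.
- exact/measurable_EFinP.
- by apply: filterS fg => x /[apply] ->.
Qed.

End AlmostEverywhere.

Lemma energy_division {R : realType} (k G t : R) :
  0 <= G -> 0 <= t -> k * t ^+ 2 <= G * t -> k * t <= G.
Proof.
move=> G0; rewrite le_eqVlt => /predU1P[<-|t0]; first by rewrite !mulr0.
by rewrite expr2 mulrA ler_pM2r //.
Qed.

(** Here a, b, t, w are the gradient norms of u1 - u2, T1 - T2, T1 and u1.
    Eliminating b, t and w leaves nu a^2 + M <= theta nu a^2, where theta is
    the quantity assumed to be less than 1. *)
Lemma smallness_forces_zero {R : realFieldType}
    (nu kap D L C6 C4 G U CN F a b t w M : R) :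
  0 < nu -> 0 < kap -> 0 < D -> 0 <= L -> 0 <= C6 -> 0 <= U -> 0 <= CN ->
  0 <= a -> 0 <= b -> 0 <= M ->
  kap * t <= G -> nu * w <= F ->
  D * b <= C4 ^+ 2 * a * t ->
  nu * a ^+ 2 + M <= L * C6 * b * U * a + CN * a ^+ 2 * w ->
  CN / nu ^+ 2 * F + L * C6 * C4 ^+ 2 * G * U / (nu * kap * D) < 1 ->
  [/\ a = 0, b = 0 & M = 0].
Proof.
move=> nu0 kap0 D0 L0 C60 U0 CN0 a0 b0 M0 tG wF bD am small.
set theta := _ + _ in small.
have w_le : w <= F / nu by rewrite ler_pdivlMr// mulrC.
have t_le : t <= G / kap by rewrite ler_pdivlMr// mulrC.
have b_le : b <= C4 ^+ 2 * a * (G / kap) / D.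
  rewrite ler_pdivlMr// mulrC; apply: le_trans bD _.
  by rewrite ler_wpM2l// mulr_ge0// sqr_ge0.
have total : nu * a ^+ 2 + M <= nu * a ^+ 2 * theta.
  apply: le_trans am _.
  have -> : nu * a ^+ 2 * theta
      = L * C6 * (C4 ^+ 2 * a * (G / kap) / D) * U * a
        + CN * a ^+ 2 * (F / nu).
    by rewrite /theta; field; rewrite !gt_eqF.
  apply: lerD; last by rewrite ler_wpM2l// mulr_ge0// sqr_ge0.
  by rewrite !ler_wpM2r// ler_wpM2l// mulr_ge0.
have a2 : 0 <= nu * a ^+ 2 by rewrite mulr_ge0 ?sqr_ge0// ltW.
have small_le : nu * a ^+ 2 * (1 - theta) <= 0 by nra.
have a2_0 : nu * a ^+ 2 = 0.
  apply/eqP; rewrite eq_le a2 andbT.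
  by rewrite -(@pmulr_lle0 _ (1 - theta)) ?subr_gt0.
have a_0 : a = 0.
  by move/eqP: a2_0; rewrite mulf_eq0 gt_eqF//= sqrf_eq0 => /eqP.
split=> //; last first.
  by apply/eqP; rewrite eq_le M0 andbT; move: total; rewrite a2_0 mul0r add0r.
apply/eqP; rewrite eq_le b0 andbT -(@pmulr_rle0 _ D)//.
by move: bD; rewrite a_0 mulr0 mul0r.
Qed.

Section DiscreteProblem.
Context {R : realType} (Omega : set (pt R)).
Hypothesis oO : open Omega.
Hypothesis bO : bounded_set Omega.
Context (fe : fe_pair R) (Th : set (set (pt R))) (nu kappa : R -> R) (s : R)
  (f : ('I_3 -> pt R -> R) -> R) (g : (pt R -> R) -> R)
  (Lnu Lkappa nu_min nu_max kappa_min kappa_max : R).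
Hypothesis s_ge2 : 0 <= s - 2.
Hypothesis nu_lipschitz : Lnu.-lipschitz nu.
Hypothesis kappa_lipschitz : Lkappa.-lipschitz kappa.
Hypothesis nu_min0 : 0 < nu_min.
Hypothesis kappa_min0 : 0 < kappa_min.
Hypothesis nu_bounds : forall r, nu_min <= nu r <= nu_max.
Hypothesis kappa_bounds : forall r, kappa_min <= kappa r <= kappa_max.
Hypothesis hf : Hm1v Omega f.
Hypothesis hg : Hm1 Omega g.

Let mO : measurable Omega. Proof. exact: open_measurable_pt. Qed.

Notation solution := (discrete_solution Omega fe Th nu kappa s f g).

Lemma temperature_energy u p T : solution u p T ->
  kappa_min * grad_norm Omega 2 T <= Hm1_norm Omega g.
Proof.
move=> [[Xu Mp YT] eqs]; have [_ _] := eqs u p T Xu Mp YT.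
rewrite (aST_diag oO) addr0 => gT; have [G0 gb] := Hm1_bound hg.
have [[mT _] gT2] := Yh_bounded_H1 oO bO YT.
apply: energy_division => //; first exact: Lp_norm_ge0.
have [_ _ hT] := YT; apply: le_trans (gb T hT); rewrite -gT.
exact: (diffusion_coercive oO kappa_min0 kappa_bounds kappa_lipschitz mT gT2).
Qed.

Lemma momentum_energy u p T : solution u p T ->
  nu_min * gradv_norm Omega 2 u <= Hm1v_norm Omega f.
Proof.
move=> [[Xu Mp YT] eqs]; have [+ pdiv _] := eqs u p T Xu Mp YT.
rewrite aSN_diag addr0 pdiv subr0 => fu; have [F0 fb] := Hm1v_bound hf.
have [[mT _] _] := Yh_bounded_H1 oO bO YT.
have bu := Xh_bounded_H1 oO bO Xu.
have gu (ij : 'I_3 * 'I_3) : inLp Omega 2 (sgrad (u ij.1) ij.2).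
  by case: (bu ij.1).
have hu : H01v Omega u by move=> i; case: (Xu i).
apply: energy_division => //; first exact: Lp_norm_ge0.
apply: le_trans (fb u hu); rewrite -fu.
have nE x : nu (T x) * ddot u u x = nu (T x) *
    \sum_(ij : 'I_3 * 'I_3) sgrad (u ij.1) ij.2 x * sgrad (u ij.1) ij.2 x.
  by rewrite ddotE.
under [X in _ <= X + _]eq_Rintegral do rewrite nE.
rewrite RintegralD//; last 2 first.
- apply/inLp1_integrable.
  exact: (diffusion_inLp1 oO nu_min0 nu_bounds nu_lipschitz mT gu gu).
- exact/inLp1_integrable/mass_inLp1.
have := diffusion_coercive oO nu_min0 nu_bounds nu_lipschitz mT gu.
rewrite -gradv_normE => /le_trans; apply.
rewrite -addrA lerDl addr_ge0//; apply: Rintegral_ge0 => x _.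
  exact: dot3_ge0.
by rewrite mulr_ge0 ?powR_ge0 ?dot3_ge0.
Qed.

(** The difference of the temperature equations is tested with T1 - T2. The
    variation of the coefficient costs L C6 |grad T1| in L^3, which the
    coercivity absorbs, and the transport of T1 by u1 - u2 remains. *)
Lemma temperature_stability C6 C4 u1 p1 T1 u2 p2 T2 :
  best_embedding_constant Omega 6 C6 -> best_embedding_constant Omega 4 C4 ->
  W1p Omega 3 T1 -> solution u1 p1 T1 -> solution u2 p2 T2 ->
  (kappa_min - Lkappa * C6 * grad_norm Omega 3 T1)
    * grad_norm Omega 2 (sobB T1 T2)
  <= C4 ^+ 2 * gradv_norm Omega 2 (vecB u1 u2) * grad_norm Omega 2 T1.
Proof.
move=> h6 h4 WT1 [[Xu1 Mp1 YT1] eqs1] [[Xu2 Mp2 YT2] eqs2].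
set e := sobB T1 T2; set eu := vecB u1 u2.
have C60 := best_embedding_constant_ge0 h6.
have C40 := best_embedding_constant_ge0 h4.
have L0 := lipschitz_ge0 kappa_lipschitz.
have Ye : Yh Omega fe Th e by exact: YhB.
have Xe : Xh Omega fe Th eu by exact: XhB.
have bT1 := Yh_bounded_H1 oO bO YT1; have bT2 := Yh_bounded_H1 oO bO YT2.
have be := Yh_bounded_H1 oO bO Ye; have beu := Xh_bounded_H1 oO bO Xe.
have bu1 := Xh_bounded_H1 oO bO Xu1; have bu2 := Xh_bounded_H1 oO bO Xu2.
have [_ _ hT1] := YT1; have [_ _ he] := Ye.
have heu : H01v Omega eu by move=> i; case: (Xe i).
have [_ _ E1] := eqs1 u1 p1 e Xu1 Mp1 Ye.
have [_ _ E2] := eqs2 u1 p1 e Xu1 Mp1 Ye.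
have [_ g3 _] := WT1.
have [e6 e6le] := embedding_Lp_norm h6.1 he.
have [_ e4le] := embedding_Lp_norm h4.1 he.
have [_ T4le] := embedding_Lp_norm h4.1 hT1.
have U4le := vector_embedding4 oO h4.1 C40 heu beu.
have diffusion : kappa_min * grad_norm Omega 2 e ^+ 2
    - Lkappa * (Lp_norm Omega 6 e * grad_norm Omega 3 T1 * grad_norm Omega 2 e)
  <= \int[vol]_(x in Omega) (kappa (T1 x) * dot3 (grad T1 x) (grad e x))
     - \int[vol]_(x in Omega) (kappa (T2 x) * dot3 (grad T2 x) (grad e x)).
  exact: (diffusion_difference oO kappa_min0 kappa_bounds kappa_lipschitz
    bT1.1.1 bT2.1.1 bT1.2 bT2.2 g3 e6).
have convection := aST_difference oO bO bu1 bu2 bT1 bT2.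
have := aST_bound oO bO beu bT1 be.
rewrite /= -/e -/eu -convection; move: E1 E2 diffusion.
move: U4le e4le T4le e6le.
set U4 := Lp_norm Omega 4 _; set E4 := Lp_norm Omega 4 _.
set T4 := Lp_norm Omega 4 _; set E6 := Lp_norm Omega 6 _.
have U40 : 0 <= U4 by exact: Lp_norm_ge0.
have E40 : 0 <= E4 by exact: Lp_norm_ge0.
have T40 : 0 <= T4 by exact: Lp_norm_ge0.
have : 0 <= grad_norm Omega 2 e by exact: Lp_norm_ge0.
have : 0 <= gradv_norm Omega 2 eu by exact: Lp_norm_ge0.
have : 0 <= grad_norm Omega 2 T1 by exact: Lp_norm_ge0.
have : 0 <= grad_norm Omega 3 T1 by exact: Lp_norm_ge0.
move: (grad_norm Omega 2 e) (gradv_norm Omega 2 eu) (grad_norm Omega 2 T1)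
  (grad_norm Omega 3 T1) (aST Omega u1 T1 e) (aST Omega u2 T2 e) => b a t G A1 A2.
move: (Rintegral _ _ _) (Rintegral _ _ _) => D1 D2.
move=> G0 t0 a0 b0 U4le E4le T4le E6le E1 E2 diffusion A12.
have b2 : (kappa_min - Lkappa * C6 * G) * b ^+ 2 <= C4 ^+ 2 * a * t * b.
  have UE : U4 * E4 <= (C4 * a) * (C4 * b) by exact: ler_pM.
  have UT : U4 * T4 <= (C4 * a) * (C4 * t) by exact: ler_pM.
  have h1 : U4 * E4 * t <= (C4 * a) * (C4 * b) * t by exact: ler_wpM2r.
  have h2 : U4 * T4 * b <= (C4 * a) * (C4 * t) * b by exact: ler_wpM2r.
  have h3 : Lkappa * (E6 * G * b) <= Lkappa * (C6 * b * G * b).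
    by rewrite ler_wpM2l// !ler_wpM2r.
  have hA : - (A1 - A2) <= 2^-1 * (U4 * E4 * t + U4 * T4 * b).
    by apply: le_trans A12; rewrite -normrN ler_norm.
  have -> : (kappa_min - Lkappa * C6 * G) * b ^+ 2
      = kappa_min * b ^+ 2 - Lkappa * (C6 * b * G * b) by ring.
  have -> : C4 ^+ 2 * a * t * b = 2^-1 * ((C4 * a) * (C4 * b) * t
      + (C4 * a) * (C4 * t) * b) by field.
  lra.
by apply: energy_division => //; rewrite !mulr_ge0// exprn_ge0.
Qed.

(** Both velocities are discretely divergence free. *)
Lemma divergence_orthogonal u1 p1 T1 u2 p2 T2 q :
  solution u1 p1 T1 -> solution u2 p2 T2 -> Mh Omega Th q ->
  \int[vol]_(x in Omega) (q x * div (vecB u1 u2) x) = 0.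
Proof.
move=> [[Xu1 Mp1 YT1] eqs1] [[Xu2 Mp2 YT2] eqs2] Mq.
have [_ d1 _] := eqs1 u1 q T1 Xu1 Mq YT1.
have [_ d2 _] := eqs2 u1 q T1 Xu1 Mq YT1.
have [q2 _ _ _] := Mq.
have bu1 := Xh_bounded_H1 oO bO Xu1; have bu2 := Xh_bounded_H1 oO bO Xu2.
transitivity (\int[vol]_(x in Omega) (q x * div u1 x - q x * div u2 x)).
  apply: eq_Rintegral => x _; rewrite -mulrBr; congr (_ * _).
  by rewrite /div -sumrB.
rewrite RintegralB//; first by rewrite d1 d2 subrr.
- by apply: inLp22_integrable => //; exact: div_inLp2.
- by apply: inLp22_integrable => //; exact: div_inLp2.
Qed.

(** Testing the difference of the momentum equations with u1 - u2 removes the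
    pressures, and the power term has a sign because it is monotone. *)
Lemma momentum_stability C6 CN u1 p1 T1 u2 p2 T2 :
  best_embedding_constant Omega 6 C6 -> convection_constant Omega CN ->
  W1pv Omega 3 u1 -> solution u1 p1 T1 -> solution u2 p2 T2 ->
  let e := vecB u1 u2 in
  nu_min * gradv_norm Omega 2 e ^+ 2
    + \int[vol]_(x in Omega) dot3 (at_pt e x) (at_pt e x)
  <= Lnu * C6 * grad_norm Omega 2 (sobB T1 T2) * gradv_norm Omega 3 u1
       * gradv_norm Omega 2 e
     + CN * gradv_norm Omega 2 e ^+ 2 * gradv_norm Omega 2 u1.
Proof.
move=> h6 hN Wu1 S1 S2; cbv zeta; set e := vecB u1 u2; set eT := sobB T1 T2.
have [[Xu1 Mp1 YT1] eqs1] := S1; have [[Xu2 Mp2 YT2] eqs2] := S2.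
have C60 := best_embedding_constant_ge0 h6.
have L0 := lipschitz_ge0 nu_lipschitz.
have Ye : Yh Omega fe Th eT by exact: YhB.
have Xe : Xh Omega fe Th e by exact: XhB.
have bT1 := Yh_bounded_H1 oO bO YT1; have bT2 := Yh_bounded_H1 oO bO YT2.
have be := Xh_bounded_H1 oO bO Xe.
have bu1 := Xh_bounded_H1 oO bO Xu1; have bu2 := Xh_bounded_H1 oO bO Xu2.
have [_ _ heT] := Ye.
have he : H01v Omega e by move=> i; case: (Xe i).
have hu1 : H01v Omega u1 by move=> i; case: (Xu1 i).
have [+ _ _] := eqs1 e p1 T1 Xe Mp1 YT1.
have [+ _ _] := eqs2 e p1 T1 Xe Mp1 YT1.
rewrite (divergence_orthogonal S1 S2 Mp1) (divergence_orthogonal S1 S2 Mp2).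
rewrite !subr0.
have [e6 e6le] := embedding_Lp_norm h6.1 heT.
have gu1 (ij : 'I_3 * 'I_3) : inLp Omega 2 (sgrad (u1 ij.1) ij.2).
  by case: (bu1 ij.1).
have gu2 (ij : 'I_3 * 'I_3) : inLp Omega 2 (sgrad (u2 ij.1) ij.2).
  by case: (bu2 ij.1).
have ge (ij : 'I_3 * 'I_3) : inLp Omega 2 (sgrad (e ij.1) ij.2).
  by case: (be ij.1).
have gu3 (ij : 'I_3 * 'I_3) : inLp Omega 3 (sgrad (u1 ij.1) ij.2).
  by case: (Wu1 ij.1).
have split_mass (T : sob R) (u : 'I_3 -> sob R) :
    bounded_H1 Omega T -> (forall i, bounded_H1 Omega (u i)) ->
    \int[vol]_(x in Omega)
      (nu (T x) * ddot u e x + dot3 (at_pt u x) (at_pt e x))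
    = \int[vol]_(x in Omega) (nu (T x) *
        \sum_(ij : 'I_3 * 'I_3) sgrad (u ij.1) ij.2 x * sgrad (e ij.1) ij.2 x)
      + \int[vol]_(x in Omega) dot3 (at_pt u x) (at_pt e x).
  move=> [[mT _] _] bu; rewrite -RintegralD//.
  - by apply: eq_Rintegral => x _; rewrite ddotE.
  - apply/inLp1_integrable.
    apply: (diffusion_inLp1 oO nu_min0 nu_bounds nu_lipschitz mT _ ge).
    by move=> ij; case: (bu ij.1).
  - exact/inLp1_integrable/mass_inLp1.
rewrite !split_mass//.
have diffusion : nu_min * gradv_norm Omega 2 e ^+ 2 - Lnu *
    (Lp_norm Omega 6 eT * gradv_norm Omega 3 u1 * gradv_norm Omega 2 e)
  <= \int[vol]_(x in Omega) (nu (T1 x) *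
       \sum_(ij : 'I_3 * 'I_3) sgrad (u1 ij.1) ij.2 x * sgrad (e ij.1) ij.2 x)
     - \int[vol]_(x in Omega) (nu (T2 x) *
       \sum_(ij : 'I_3 * 'I_3) sgrad (u2 ij.1) ij.2 x * sgrad (e ij.1) ij.2 x).
  rewrite !gradv_normE.
  exact: (diffusion_difference oO nu_min0 nu_bounds nu_lipschitz
    bT1.1.1 bT2.1.1 gu1 gu2 gu3 e6).
have mass : \int[vol]_(x in Omega) dot3 (at_pt u1 x) (at_pt e x)
    - \int[vol]_(x in Omega) dot3 (at_pt u2 x) (at_pt e x)
  = \int[vol]_(x in Omega) dot3 (at_pt e x) (at_pt e x).
  rewrite -RintegralB//; [|exact/inLp1_integrable/mass_inLp1..].
  by apply: eq_Rintegral => x _; rewrite -dot3Bl.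
have power : 0 <=
    \int[vol]_(x in Omega)
      (enorm (at_pt u1 x) `^ (s - 2) * dot3 (at_pt u1 x) (at_pt e x))
    - \int[vol]_(x in Omega)
      (enorm (at_pt u2 x) `^ (s - 2) * dot3 (at_pt u2 x) (at_pt e x)).
  rewrite -RintegralB//; [|exact/inLp1_integrable/forchheimer_inLp1..].
  by apply: Rintegral_ge0 => x _; exact: power_field_monotone.
have := aSN_bound hN he hu1 he.
rewrite -(aSN_difference oO bO bu1 bu2) -/e; move: diffusion mass power e6le.
set E6 := Lp_norm Omega 6 _.
have E60 : 0 <= E6 by exact: Lp_norm_ge0.
have : 0 <= gradv_norm Omega 2 e by exact: Lp_norm_ge0.
have : 0 <= grad_norm Omega 2 eT by exact: Lp_norm_ge0.
have : 0 <= gradv_norm Omega 3 u1 by exact: Lp_norm_ge0.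
move: (gradv_norm Omega 2 e) (grad_norm Omega 2 eT) (gradv_norm Omega 3 u1)
  (gradv_norm Omega 2 u1) (aSN Omega u1 u1 e) (aSN Omega u2 u2 e) (f _)
  => a b G w A1 A2 fe'.
move: (Rintegral _ _ _) (Rintegral _ _ _) (Rintegral _ _ _) (Rintegral _ _ _)
  (Rintegral _ _ _) (Rintegral _ _ _) (Rintegral _ _ _)
  => D1 D2 M1 M2 M F1 F2.
move=> G0 b0 a0 diffusion mass power E6le A12 eq2 eq1.
have h3 : Lnu * (E6 * G * a) <= Lnu * (C6 * b * G * a).
  by rewrite ler_wpM2l// !ler_wpM2r.
have hA : - (A1 - A2) <= CN * a * w * a.
  by apply: le_trans A12; rewrite -normrN ler_norm.
have -> : Lnu * C6 * b * G * a = Lnu * (C6 * b * G * a) by ring.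
have -> : CN * a ^+ 2 * w = CN * a * w * a by ring.
lra.
Qed.

(** * Uniqueness *)

(** The inf-sup quotient of a pressure orthogonal to every divergence is zero
    for each velocity, so a positive lower bound excludes such a pressure. *)
Lemma infsup_orthogonal_eq0 (beta : R) (q : pt R -> R) :
  0 < beta -> (beta%:E <= infsup Omega fe Th)%E -> Mh Omega Th q ->
  (forall v, Xh Omega fe Th v -> \int[vol]_(x in Omega) (q x * div v x) = 0) ->
  forall x, Omega x -> q x = 0.
Proof.
move=> beta0 hb Mq q0 x Ox; apply: contrapT => /eqP qx.
have : (infsup Omega fe Th <= 0%:E)%E.
  apply: le_trans (ereal_inf_lbound _) _.
    by exists q => //; split => //; exists x.
  apply: ge_ereal_sup => _ [v [Xv _] <-].
  by rewrite q0// mul0r.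
by move=> /(le_trans hb); rewrite lee_fin leNgt beta0.
Qed.

(** The velocities and temperatures agree, and the gradients of the
    velocities agree almost everywhere, so the momentum equations differ only
    in their pressure terms. *)
Lemma pressure_orthogonal u1 p1 T1 u2 p2 T2 :
  solution u1 p1 T1 -> solution u2 p2 T2 ->
  (forall x, Omega x -> forall i, u1 i x = u2 i x) ->
  (forall x, Omega x -> T1 x = T2 x) ->
  gradv_norm Omega 2 (vecB u1 u2) = 0 ->
  forall v, Xh Omega fe Th v ->
    \int[vol]_(x in Omega) ((p1 x - p2 x) * div v x) = 0.
Proof.
move=> [[Xu1 Mp1 YT1] eqs1] [[Xu2 Mp2 YT2] eqs2] uE TE g0 v Xv.
have bu1 := Xh_bounded_H1 oO bO Xu1; have bu2 := Xh_bounded_H1 oO bO Xu2.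
have bv := Xh_bounded_H1 oO bO Xv.
have bT1 := Yh_bounded_H1 oO bO YT1; have bT2 := Yh_bounded_H1 oO bO YT2.
have gradE : {ae vol, forall x, Omega x ->
    forall i j, sgrad (u1 i) j x = sgrad (u2 i) j x}.
  rewrite gradv_normE in g0.
  have ge (ij : 'I_3 * 'I_3) : inLp Omega 2 (sgrad (vecB u1 u2 ij.1) ij.2).
    by apply: inLpB => //; [lra|case: (bu1 ij.1)|case: (bu2 ij.1)].
  have : 1 <= 2 :> R by lra.
  move=> /(length_eq0_ae oO)/(_ ge g0).
  by apply: filterS => x + Ox i j; move=> /(_ Ox (i, j))/eqP; rewrite subr_eq0 => /eqP.
have atE x : Omega x -> at_pt u1 x = at_pt u2 x.
  by move=> Ox; apply/funext => i; exact: uE.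
have [+ _ _] := eqs1 v p1 T1 Xv Mp1 YT1.
have [+ _ _] := eqs2 v p1 T1 Xv Mp1 YT1.
have viscous_measurable (T : sob R) (u : 'I_3 -> sob R) :
    bounded_H1 Omega T -> (forall i, bounded_H1 Omega (u i)) ->
    measurable_fun Omega
      (fun x => nu (T x) * ddot u v x + dot3 (at_pt u x) (at_pt v x)).
  move=> [[mT _] _] bu.
  have gu (ij : 'I_3 * 'I_3) : inLp Omega 2 (sgrad (u ij.1) ij.2).
    by case: (bu ij.1).
  have gv (ij : 'I_3 * 'I_3) : inLp Omega 2 (sgrad (v ij.1) ij.2).
    by case: (bv ij.1).
  apply: measurable_funD; last by case: (mass_inLp1 oO bO bu bv).
  have [+ _] := diffusion_inLp1 oO nu_min0 nu_bounds nu_lipschitz mT gu gv.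
  by congr (measurable_fun _ _); apply/funext => x; rewrite ddotE.
have -> : \int[vol]_(x in Omega)
      (nu (T1 x) * ddot u1 v x + dot3 (at_pt u1 x) (at_pt v x))
    = \int[vol]_(x in Omega)
      (nu (T2 x) * ddot u2 v x + dot3 (at_pt u2 x) (at_pt v x)).
  apply: Rintegral_ae_eq; [exact: oO|exact: viscous_measurable..|].
  apply: filterS gradE => x gx Ox.
  rewrite TE// atE//; congr (_ * _ + _); apply: eq_bigr => i _.
  by apply: eq_bigr => j _; rewrite /grad gx.
have -> : aSN Omega u1 u1 v = aSN Omega u2 u2 v.
  rewrite /aSN; congr (_ * (_ - _)).
    apply: Rintegral_ae_eq; [exact: oO| | |].
    - by case: (aN_inLp1 oO bO bu1 bu1 bv).
    - by case: (aN_inLp1 oO bO bu2 bu2 bv).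
    apply: filterS gradE => x gx Ox; rewrite atE//.
    apply: eq_bigr => i _; congr (_ * _).
    by apply: eq_bigr => j _; rewrite /grad gx.
  apply: eq_Rintegral => x /[!inE] Ox; rewrite atE//.
  by apply: eq_bigr => i _; rewrite uE.
have -> : \int[vol]_(x in Omega)
      (enorm (at_pt u1 x) `^ (s - 2) * dot3 (at_pt u1 x) (at_pt v x))
    = \int[vol]_(x in Omega)
      (enorm (at_pt u2 x) `^ (s - 2) * dot3 (at_pt u2 x) (at_pt v x)).
  by apply: eq_Rintegral => x /[!inE] Ox; rewrite atE.
move=> e2 e1.
under eq_Rintegral do rewrite mulrBl.
rewrite RintegralB//.
- by apply/eqP; rewrite subr_eq0; apply/eqP; lra.
- by apply: inLp22_integrable => //; [case: Mp1|exact: div_inLp2].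
- by apply: inLp22_integrable => //; [case: Mp2|exact: div_inLp2].
Qed.

End DiscreteProblem.

Theorem theorem4p2 (R : realType) (Omega : set (pt R))
    (hOmega : lipschitz_polytope Omega)
    (T0 : set (set (pt R))) (TT : set (set (set (pt R))))
    (hTT : mesh_family Omega T0 TT)
    (fe : fe_pair R) (hfe : fe_admissible fe TT)
    (hinfsup : uniform_infsup Omega fe TT)
    (s : R) (hs : 3 <= s <= 4)
    (nu kappa : R -> R)
    (Lnu Lkappa nu_min nu_max kappa_min kappa_max : R)
    (hLnu : Lnu.-lipschitz nu) (hLkappa : Lkappa.-lipschitz kappa)
    (hnu_min : 0 < nu_min) (hnu_max : 0 < nu_max)
    (hkappa_min : 0 < kappa_min) (hkappa_max : 0 < kappa_max)
    (hnu : forall r, nu_min <= nu r <= nu_max)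
    (hkappa : forall r, kappa_min <= kappa r <= kappa_max)
    (f : ('I_3 -> pt R -> R) -> R) (hf : Hm1v Omega f)
    (g : (pt R -> R) -> R) (hg : Hm1 Omega g)
    (CN C6 C4 : R) (hCN : convection_constant Omega CN)
    (hC6 : best_embedding_constant Omega 6 C6)
    (hC4 : best_embedding_constant Omega 4 C4)
    (Th : set (set (pt R))) (hTh : TT Th)
    (u1 : 'I_3 -> sob R) (p1 : pt R -> R) (T1 : sob R)
    (hsol1 : discrete_solution Omega fe Th nu kappa s f g u1 p1 T1)
    (hu1 : W1pv Omega 3 u1) (hT1 : W1p Omega 3 T1)
    (hsmall : CN / nu_min ^+ 2 * Hm1v_norm Omega f
              + Lnu * C6 * C4 ^+ 2 * Hm1_norm Omega g * gradv_norm Omega 3 u1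
                / (nu_min * kappa_min
                   * (kappa_min - Lkappa * C6 * grad_norm Omega 3 T1)) < 1)
    (hsmallT : Lkappa * C6 * grad_norm Omega 3 T1 < kappa_min) :
  forall (u2 : 'I_3 -> sob R) (p2 : pt R -> R) (T2 : sob R),
    discrete_solution Omega fe Th nu kappa s f g u2 p2 T2 ->
    forall x, closure Omega x ->
      [/\ forall i, u2 i x = u1 i x, p2 x = p1 x & T2 x = T1 x].
Proof.
move=> u2 p2 T2 hsol2.
have [oO bO _ _] := hOmega.
have mO : measurable Omega by exact: open_measurable_pt.
have s2 : 0 <= s - 2 by lra.
have [[Xu1 Mp1 YT1] _] := hsol1; have [[Xu2 Mp2 YT2] _] := hsol2.
have L0 := lipschitz_ge0 hLnu.
have C60 := best_embedding_constant_ge0 hC6.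
set e := vecB u1 u2; set eT := sobB T1 T2.
have Xe : Xh Omega fe Th e by exact: XhB.
have Ye : Yh Omega fe Th eT by exact: YhB.
have be := Xh_bounded_H1 oO bO Xe.
have [cT _ heT] := Ye.
have M0 : 0 <= \int[vol]_(x in Omega) dot3 (at_pt e x) (at_pt e x).
  by apply: Rintegral_ge0 => x _; exact: dot3_ge0.
have D0 : 0 < kappa_min - Lkappa * C6 * grad_norm Omega 3 T1 by rewrite subr_gt0.
have U_ge0 : 0 <= gradv_norm Omega 3 u1 by exact: Lp_norm_ge0.
have a_ge0 : 0 <= gradv_norm Omega 2 e by exact: Lp_norm_ge0.
have b_ge0 : 0 <= grad_norm Omega 2 eT by exact: Lp_norm_ge0.
have [a0 b0 mass0] := smallness_forces_zero hnu_min hkappa_min D0 L0 C60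
  U_ge0 (ltW hCN.1) a_ge0 b_ge0 M0
  (temperature_energy oO bO hLkappa hkappa_min hkappa hg hsol1)
  (momentum_energy oO bO hLnu hnu_min hnu hf hsol1)
  (temperature_stability oO bO hLkappa hkappa_min hkappa hC6 hC4 hT1 hsol1 hsol2)
  (momentum_stability oO bO s2 hLnu hnu_min hnu hC6 hCN hu1 hsol1 hsol2)
  hsmall.
have TE x : closure Omega x -> T1 x = T2 x.
  move=> cOx; apply/eqP; rewrite -subr_eq0; apply/eqP; move: x cOx.
  apply: (continuous_ae0 oO cT).
  have [e6 e6le] := embedding_Lp_norm hC6.1 heT.
  apply: (Lp_norm_eq0_ae oO) e6 _ => //.
  by apply/eqP; rewrite eq_le Lp_norm_ge0 andbT (le_trans e6le)// b0 mulr0.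
have uE x : closure Omega x -> forall i, u1 i x = u2 i x.
  move=> cOx i; apply/eqP; rewrite -subr_eq0; apply/eqP; move: x cOx.
  have [ce _ _] := Xe i; apply: (continuous_ae0 oO ce).
  have e2 j : inLp Omega 2 (e j) by case: (be j) => bj _; exact: bounded_inLp.
  have : 1 <= 2 :> R by lra.
  move=> /(length_eq0_ae oO)/(_ e2).
  have -> : Lp_norm Omega 2 (euclidean_length (fun j => e j)) = 0.
    by apply/eqP; rewrite -sqrf_eq0 (Lp_norm2_length oO e2); exact/eqP.
  by move=> /(_ erefl); apply: filterS => x + Ox; exact.
have [beta beta0 hbeta] := hinfsup.
have Mq : Mh Omega Th (fun x => p1 x - p2 x) by exact: MhB.
have pO x : Omega x -> p1 x - p2 x = 0.
  apply: (infsup_orthogonal_eq0 beta0 (hbeta Th hTh) Mq).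
  apply: (pressure_orthogonal oO bO hLnu hnu_min hnu hsol1 hsol2) a0.
  - by move=> y /subset_closure; exact: uE.
  - by move=> y /subset_closure; exact: TE.
have pE x : closure Omega x -> p1 x = p2 x.
  move=> cOx; apply/eqP; rewrite -subr_eq0; apply/eqP; move: x cOx.
  have [_ _ cq _] := Mq; apply: (continuous_ae0 oO cq).
  exact: aeW.
by move=> x cOx; split => [i||]; rewrite ?uE ?pE ?TE.
Qed.
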